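(* Let $(k_n)_{n\ge 2}$ be a sequence of integers with $2\le k_n\le n$ for all $n$ and $k_n/n\to 0$ as $n\to\infty$. Define $$t_n := \frac{n\log n}{k_n-k_n/(2k_n-1)}=\frac{n}{k_n}\log n\cdot\frac{1}{1-1/(2k_n-1)} .$$ Then the sequence of $k_n$-perfect matching random walks $M_{n,k_n}$ on $\mathfrak M_n$ exhibits cutoff at time $(t_n)_n$. In particular, if $k_n\to\infty$ as $n\to\infty$, then $t_n=\frac{n}{k_n}\log n\cdot(1+o(1))$.
   Context: For $n\in\mathbb N$, $\mathfrak M_n$ denotes the set of perfect matchings of $[2n]=\{1,\dots,2n\}$, i.e. the set of partitions of $[2n]$ into $n$ unordered pairs. For $k\in\{2,\dots,n\}$, the $k$-perfect matching random walk $M_{n,k}=(M_{t,n,k})_{t\ge 0}$ is the discrete-time Markov chain on $\mathfrak M_n$ with the following step: from the current matching, choose $k$ of its $n$ matched pairs uniformly at random; break these pairs, giving $2k$ unpaired elements; re-pair these $2k$ elements according to a uniformly random perfect matching of them (independently of everything else), leaving the other $n-k$ pairs unchanged. The invariant distribution $\pi_n$ is uniform on $\mathfrak M_n$. Total variation distance between probability measures on a finite set $\Omega$: $\|\mu-\nu\|_{\mathrm{TV}}=\sup_{A\subseteq\Omega}|\mu(A)-\nu(A)|$. For a sequence of ergodic chains $X_n=(X_{t,n})_{t\ge 0}$ on finite state spaces $\Omega_n$ with invariant distributions $\pi_n$, set $d_n(t)=\max_{x\in\Omega_n}\|\mathbb P_x(X_{t,n}\in\cdot)-\pi_n\|_{\mathrm{TV}}$,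 where for non-integer $t\ge0$ the time $t$ is read as $\lfloor t\rfloor$. The sequence exhibits cutoff at time $(t_n)_n$ if for all $\delta\in(0,1)$, $$\liminf_{n\to\infty} d_n((1-\delta)t_n)=1\quad\text{and}\quad \limsup_{n\to\infty} d_n((1+\delta)t_n)=0 .$$ *)

(* Defs.v *)
From mathcomp Require Import all_boot all_order all_algebra.
From mathcomp Require Import all_classical all_reals all_analysis.
Import Order.TTheory GRing.Theory Num.Theory.
Import numFieldNormedType.Exports.

Set Implicit Arguments.
Unset Strict Implicit.
Unset Printing Implicit Defensive.

Local Open Scope ring_scope.

Definition is_perfect_matching (T : finType) (A : {set T}) (M : {set {set T}}) :
    bool :=
  finset.partition M A && [forall B in M, #|B| == 2%N].

Definition perfect_matchings (T : finType) (A : {set T}) : {set {set {set T}}} :=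
  [set M | is_perfect_matching A M].

(* The ground set {1, ..., 2n} is represented by 'I_(2 * n). *)
Definition matching (n : nat) : finType :=
  {M : {set {set 'I_(2 * n)}} | is_perfect_matching [set: 'I_(2 * n)] M}.

Definition uniform_pmf (R : realType) (T : finType) (A : {set T}) (x : T) : R :=
  (x \in A)%:R / #|A|%:R.

(* S is the set of the k broken pairs, so that [finset.cover S] is the set of the 2k
   unpaired elements, and N is their new matching. *)
Definition matching_step (R : realType) (n k : nat) (M M' : matching n) : R :=
  \sum_(S : {set {set 'I_(2 * n)}})
    uniform_pmf R [set S' : {set {set 'I_(2 * n)}} |
                    (S' \subset val M) && (#|S'| == k)] S *
    \sum_(N : {set {set 'I_(2 * n)}})
      uniform_pmf R (perfect_matchings (finset.cover S)) N *
      (val M' == (val M :\: S) :|: N)%:R.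

Fixpoint iter_step (R : realType) (Omega : finType) (P : Omega -> Omega -> R)
    (t : nat) (x y : Omega) : R :=
  if t is t'.+1 then \sum_(z : Omega) P x z * iter_step P t' z y
  else (x == y)%:R.

Definition pr (R : realType) (Omega : finType) (mu : Omega -> R)
    (A : {set Omega}) : R :=
  \sum_(x in A) mu x.

Definition tv_dist (R : realType) (Omega : finType) (mu nu : Omega -> R) : R :=
  \big[Num.max/0]_(A : {set Omega}) `|pr mu A - pr nu A|.

(* For t >= 0, [Num.truncn t] is the integer part of t, as a natural number. *)
Definition worst_tv (R : realType) (Omega : finType) (P : Omega -> Omega -> R)
    (pi : Omega -> R) (t : R) : R :=
  \big[Num.max/0]_(x : Omega) tv_dist (iter_step P (Num.truncn t) x) pi.

(* P n is the transition matrix of the n-th chain and pi n its invariant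
   distribution. *)
Definition cutoff_at (R : realType) (Omega : nat -> finType)
    (P : forall n, Omega n -> Omega n -> R) (pi : forall n, Omega n -> R)
    (t : nat -> R) : Prop :=
  forall delta : R, 0 < delta < 1 ->
    limn_einf (fun n => (worst_tv (P n) (pi n) ((1 - delta) * t n))%:E) = 1%:E /\
    limn_esup (fun n => (worst_tv (P n) (pi n) ((1 + delta) * t n))%:E) = 0%:E.

Definition cutoff_time (R : realType) (n k : nat) : R :=
  n%:R * ln n%:R / (k%:R - k%:R / (2 * k%:R - 1)).

Definition matching_pi (R : realType) (n : nat) : matching n -> R :=
  uniform_pmf R [set: matching n].

(* Main.v *)
(** Writing [hat f G] for the sum of a function [f] over the matchings containing a
    set [G] of pairs, one step of the walk is, up to a constant, [f |-> (M |-> sum of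
    [hat f G] over the [G] of [n - k] pairs of [M])]. Filter functions by the least
    level [j = #|G|] at which [hat f] does not vanish. If [f] is an eigenfunction of
    level [j], then [hat f], restricted to the matchings of a suitable set of [2j]
    points, satisfies an eigenvalue equation for a positive combination of walks
    re-matching [i <= k] of its [j] pairs. Bounding these walks by [1] gives the sharp
    estimate [exp (- (1 - o(1)) j r / n)], [r = k - k/(2k - 1)], when [j/n] is small;
    bounding them by induction gives a product formula that is good enough for all
    other [j]. At most [binomial (binomial 2n 2) j] eigenvalues can exceed the bounds
    of the levels above [j], and by symmetry the total variation distance is
    controlled by the trace of the walk, whence the upper bound on the mixing time.

    For the lower bound, the pairs of the initial matching that are still present
    number about [n^delta] at time [(1 - delta) t_n] by the second moment method, while
    a uniform matching contains at most one of them on average. *)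

Require Import Defs.
From mathcomp Require Import all_boot all_order all_algebra all_fingroup.
From mathcomp Require Import zify ring lra.
From mathcomp.real_closed Require Import complex.
From mathcomp Require Import reals.
Import Order.TTheory GRing.Theory Num.Theory.

Set Implicit Arguments.
Unset Strict Implicit.
Unset Printing Implicit Defensive.

Local Open Scope ring_scope.

(** * Symmetric real matrices and kernels *)

(** There is no slack at small levels: level [j] may carry about n^(2j) eigenvalues, and at time t_n
    the square of exp (- j r t / n) is exactly n^(-2j). The constant r therefore has to come out
    right. It arises from two cases for a set of [j] pairs: either no broken pair lies in it, with
    probability about exp (- j k / n), or just one does and is re-formed, which contributes about (j
    / n) k / (2k - 1) times that probability; cases with more broken pairs are of second order in j
    / n.

    Functions whose [hat] vanishes below a given level form a class stable under the walk, so the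
    Rayleigh quotient on the class is governed by the eigenvectors in it, and only for eigenvectors
    does the equation on 2j points close up. The induction can be iterated because [hat f] itself
    vanishes at low levels on these 2j points whenever few pairs are left outside them. *)

Lemma row_norm_gt0 (R : realDomainType) n (v : 'rV[R]_n) :
  v != 0 -> 0 < (v *m v^T) 0 0.
Proof.
move=> v0; have vE : (v *m v^T) 0 0 = \sum_i v 0 i ^+ 2.
  by rewrite mxE; apply: eq_bigr => i _; rewrite mxE expr2.
rewrite lt_def vE sumr_ge0 ?andbT; last by move=> i _; exact: sqr_ge0.
apply: contra v0 => /eqP /psumr_eq0P v0; apply/eqP/rowP => i; rewrite mxE.
by apply/eqP; rewrite -sqrf_eq0; apply/eqP/v0 => // j _; exact: sqr_ge0.
Qed.

(** Over the complex extension of [R] the matrix is Hermitian, so its spectrum is real; being an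
    eigenvalue is a rank condition and descends to [R]. *)
Lemma symmetric_eigenvector (R : rcfType) n (A : 'M[R]_n.+1) :
  A^T = A -> exists (a : R) (v : 'rV[R]_n.+1), v *m v^T = 1%:M /\ v *m A = a *: v.
Proof.
move=> symA; pose B : 'M[R[i]]_n.+1 := map_mx (real_complex R) A.
have hermB : B \is hermsymmx.
  apply: realsym_hermsym.
    by apply/is_hermitianmxP; rewrite expr0 scale1r map_mx_id // map_trmx symA.
  by apply/mxOverP => i j; rewrite mxE complex_real.
have /mxOverP/(_ 0 0)/complex_realP [a aE] := hermitian_spectral_diag_real hermB.
have aB : eigenvalue B a%:C%C.
  rewrite -aE; apply/eigenvalueP; exists (row 0 (spectralmx B)); last first.
    have /row_freePn : row_free (spectralmx B).
      by rewrite row_free_unit spectral_unit.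
    move=> h; apply/negP => /eqP h0; apply: h; exists 0.
    by rewrite h0 sub0mx.
  have /hermitian_normalmx /orthomx_spectralP BE := hermB.
  have VB : spectralmx B *m B = diag_mx (spectral_diag B) *m spectralmx B.
    by rewrite {2}BE !mulmxA mulmxV ?spectral_unit // mul1mx.
  by rewrite -row_mul VB row_mul row_diag_mx -scalemxAl -rowE.
move: aB; rewrite (eigenvalue_map (real_complex R)) => /eigenvalueP [w wA w0].
have nw := row_norm_gt0 w0; pose s := Num.sqrt ((w *m w^T) 0 0).
have s0 : s != 0 by rewrite gt_eqF // sqrtr_gt0.
exists a, (s^-1 *: w); split; last by rewrite -scalemxAl wA !scalerA mulrC.
apply/matrixP => i j; rewrite !ord1 linearZ /= -scalemxAl -scalemxAr scalerA.
rewrite [LHS]mxE -(sqr_sqrtr (ltW nw)) -/s mxE eqxx mulr1n.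
by rewrite expr2 mulrACA mulVf // mulr1.
Qed.

(** For [v != e], [H] is the Householder reflection in the hyperplane orthogonal to [v - e], which
    exchanges [v] and the first basis vector [e]. *)
Lemma orthogonal_completion (R : rcfType) n (v : 'rV[R]_n.+1) :
  v *m v^T = 1%:M ->
  exists H : 'M[R]_n.+1, H *m H^T = 1%:M /\ delta_mx 0 0 *m H = v.
Proof.
move=> v1; pose e : 'rV[R]_n.+1 := delta_mx 0 0.
have [->|ve] := eqVneq v e.
  by exists 1%:M; rewrite trmx1 !mulmx1.
pose w := v - e; have w0 : w != 0 by rewrite subr_eq0.
pose N := (w *m w^T) 0 0; have N0 : N != 0 by rewrite gt_eqF // row_norm_gt0.
have wwE : w *m w^T = N%:M by rewrite [LHS]mx11_scalar.
pose H : 'M[R]_n.+1 := 1%:M - (2 / N) *: (w^T *m w).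
have HT : H^T = H.
  by rewrite /H linearB /= trmx1 linearZ /= trmx_mul trmxK.
exists H; split.
  pose X := w^T *m w; have XX : X *m X = N *: X.
    by rewrite /X mulmxA -(mulmxA w^T) wwE mul_mx_scalar scalemxAl.
  rewrite HT /H -/X mulmxBl mul1mx mulmxBr mulmx1 -scalemxAl -scalemxAr XX.
  rewrite !scalerA (_ : 2 / N * (2 / N) * N = 2 / N + 2 / N); last by field.
  by rewrite scalerDl opprB addrK subrK.
have e1 : e *m e^T = 1%:M.
  by apply/matrixP => i j; rewrite !ord1 trmx_delta mul_delta_mx !mxE.
have evE : v *m e^T = e *m v^T.
  rewrite -[RHS]trmxK trmx_mul trmxK.
  by apply/matrixP => i j; rewrite !ord1 [RHS]mxE.
have ewE : e *m w^T = (- N / 2)%:M.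
  rewrite [LHS]mx11_scalar; congr _%:M.
  have -> : N = 2 - 2 * (e *m v^T) 0 0.
    rewrite /N /w linearB /= mulmxBl !mulmxBr v1 e1 evE.
    by move: (e *m v^T) => z; rewrite !mxE !eqxx /= mulr1n; ring.
  by rewrite /w linearB /= mulmxBr e1; move: (e *m v^T) => z; rewrite !mxE !eqxx /= mulr1n; field.
rewrite -/e /H mulmxBr mulmx1 -scalemxAr mulmxA ewE mul_scalar_mx scalerA.
rewrite (_ : 2 / N * _ = -1) ?scaleN1r ?opprK; last by field.
by rewrite addrC subrK.
Qed.

(** Deflation: conjugating by an orthogonal matrix whose first row is an eigenvector splits off a
    block of size one. *)
Lemma real_spectral (R : rcfType) n (A : 'M[R]_n) : A^T = A ->
  exists (U : 'M[R]_n) (d : 'rV[R]_n),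
    U *m U^T = 1%:M /\ A = U^T *m diag_mx d *m U.
Proof.
elim: n A => [|n IH] A symA.
  by exists 0, 0; split; apply/matrixP; case.
have [a [v [v1 vA]]] := symmetric_eigenvector symA.
have [H [HH eH]] := orthogonal_completion v1.
have HH' : H^T *m H = 1%:M by apply: mulmx1C.
have [B defB] : exists B : 'M[R]_n.+1, B = H *m A *m H^T by exists (H *m A *m H^T).
have symB : B^T = B by rewrite defB !trmx_mul trmxK symA mulmxA.
have B0 j : B 0 j = a * (0 == j)%:R.
  have -> : B 0 j = (delta_mx 0 0 *m B : 'rV_n.+1) 0 j by rewrite -rowE [RHS]mxE.
  by rewrite defB 2!mulmxA eH vA -scalemxAl -eH -mulmxA HH mulmx1 !mxE eqxx /= [0 == j]eq_sym.
have symD : (@drsubmx _ 1 n 1 n B)^T = @drsubmx _ 1 n 1 n B.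
  by rewrite trmx_drsub symB.
have [U' [d' [UU dE]]] := IH _ symD.
have l0 : lshift n (0 : 'I_1) = 0 :> 'I_n.+1 by exact/val_inj.
have BE : (B : 'M[R]_(1 + n)) = block_mx a%:M 0 0 (@drsubmx _ 1 n 1 n B).
  rewrite -{1}(submxK (B : 'M[R]_(1 + n))); congr block_mx.
  - apply/matrixP => i j; rewrite !ord1 [LHS]mxE [LHS]mxE l0 B0.
    by rewrite !mxE !eqxx mulr1.
  - by apply/matrixP => i j; rewrite !ord1 [LHS]mxE [LHS]mxE l0 B0 !mxE mulr0.
  - apply/matrixP => i j; rewrite !ord1 [LHS]mxE [LHS]mxE l0 -symB mxE B0.
    by rewrite !mxE mulr0.
pose V : 'M[R]_(1 + n) := block_mx 1%:M 0 0 U'.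
have VV : V *m V^T = 1%:M.
  rewrite /V tr_block_mx mulmx_block.
  by rewrite !trmx0 !mulmx0 !mul0mx !addr0 !add0r trmx1 mulmx1 UU -scalar_mx_block.
have BV : (B : 'M[R]_(1 + n)) = V^T *m diag_mx (row_mx a%:M d') *m V.
  rewrite BE dE diag_mx_row /V tr_block_mx !mulmx_block.
  rewrite !trmx0 !mulmx0 !mul0mx !addr0 !add0r ?trmx1 ?mulmx1 ?mul1mx.
  congr block_mx; rewrite ?mul0mx ?addr0 ?mulmx0 ?mulmxA //.
  by apply/matrixP => i j; rewrite !ord1 !mxE eqxx !mulr1n.

exists (V *m H), (row_mx a%:M d'); split.
  by rewrite trmx_mul mulmxA -(mulmxA V) HH mulmx1.
have -> : A = H^T *m B *m H.
  by rewrite defB !mulmxA HH' mul1mx -mulmxA HH' mulmx1.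
by rewrite trmx_mul BV !mulmxA.
Qed.

Section SymmetricKernel.
Context (R : rcfType) (Y : finType) (D : {set Y}) (kap : Y -> Y -> R).

Definition kact (f : Y -> R) (x : Y) : R := \sum_(y in D) kap x y * f y.

(** The first clause is completeness, the second orthonormality; only values on [D] are
    constrained. *)
Definition eigenbasis (e : 'I_#|D| -> Y -> R) (d : 'I_#|D| -> R) : Prop :=
  [/\ {in D &, forall x y, \sum_m e m x * e m y = (x == y)%:R},
      forall m m', \sum_(x in D) e m x * e m' x = (m == m')%:R
    & forall m, {in D, forall x, kact (e m) x = d m * e m x}].

Hypothesis kap_sym : forall x y, kap x y = kap y x.

Lemma eigenbasis_exists : exists e d, eigenbasis e d.
Proof.
pose A : 'M[R]_#|D| := \matrix_(i, j) kap (enum_val i) (enum_val j).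
have symA : A^T = A by apply/matrixP => i j; rewrite !mxE kap_sym.
have [U [d [UU AE]]] := real_spectral symA.
have UU' : U^T *m U = 1%:M by apply: mulmx1C.
have UA : U *m A = diag_mx d *m U by rewrite AE !mulmxA UU mul1mx.
pose e m x := \sum_i U m i * (x == enum_val i)%:R.
have eE m i : e m (enum_val i) = U m i.
  rewrite /e (bigD1 i) //= eqxx mulr1 big1 ?addr0 // => j ji.
  by rewrite (inj_eq enum_val_inj) eq_sym (negbTE ji) mulr0.
exists e, (d 0); split.
- move=> x y xD yD; rewrite -(enum_rankK_in xD xD) -(enum_rankK_in xD yD).
  set i := enum_rank_in _ _; set j := enum_rank_in _ _.
  under eq_bigr do rewrite !eE.
  have /matrixP/(_ i j) := UU'; rewrite !mxE (inj_eq enum_val_inj) => <-.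
  by apply: eq_bigr => m _; rewrite mxE.
- move=> m m'; rewrite big_enum_val /=.
  under eq_bigr do rewrite !eE.
  have /matrixP/(_ m m') := UU; rewrite !mxE => <-.
  by apply: eq_bigr => i _; rewrite mxE.
- move=> m x xD; rewrite -(enum_rankK_in xD xD); set i := enum_rank_in _ _.
  rewrite /kact big_enum_val /= eE.
  under eq_bigr do rewrite eE.
  have /matrixP/(_ m i) := UA; rewrite mul_diag_mx !mxE => <-.
  by apply: eq_bigr => j _; rewrite mxE mulrC kap_sym.
Qed.

Variables (e : 'I_#|D| -> Y -> R) (d : 'I_#|D| -> R).
Hypothesis ed : eigenbasis e d.

Let coord m (f : Y -> R) := \sum_(x in D) f x * e m x.

Lemma coord_expand f : {in D, forall x, f x = \sum_m coord m f * e m x}.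
Proof.
move=> x xD; have [ortho _ _] := ed.
under eq_bigr do rewrite mulr_suml.
rewrite exchange_big /= (bigD1 x) //= [X in _ + X]big1 ?addr0.
  under eq_bigr do rewrite -mulrA.
  by rewrite -mulr_sumr ortho // eqxx mulr1.
move=> y /andP[yD yx]; under eq_bigr do rewrite -mulrA.
by rewrite -mulr_sumr ortho // (negbTE yx) mulr0.
Qed.

Lemma parseval f g :
  \sum_(x in D) f x * g x = \sum_m coord m f * coord m g.
Proof.
under [RHS]eq_bigr do rewrite mulr_sumr.
rewrite exchange_big /=; apply: eq_bigr => x xD.
rewrite {1}(coord_expand f xD) mulr_suml; apply: eq_bigr => m _.
by rewrite -mulrA (mulrC (e m x)).
Qed.

Lemma coord_kact f m : coord m (kact f) = d m * coord m f.
Proof.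
have [_ _ eig] := ed; rewrite /coord /kact.
under eq_bigr do rewrite mulr_suml.
rewrite exchange_big /= mulr_sumr; apply: eq_bigr => y yD.
rewrite mulrCA -(eig m y yD) /kact mulr_sumr; apply: eq_bigr => x _.
by rewrite kap_sym mulrCA mulrA mulrC mulrA mulrAC.
Qed.

Lemma kact_form f :
  \sum_(x in D) f x * kact f x = \sum_m d m * coord m f ^+ 2.
Proof.
by rewrite parseval; apply: eq_bigr => m _; rewrite coord_kact expr2 mulrCA.
Qed.

Definition kshift (lam : R) (f : Y -> R) (x : Y) : R := kact f x - lam * f x.

Lemma coord_kshift lam f m : coord m (kshift lam f) = (d m - lam) * coord m f.
Proof.
rewrite mulrBl -coord_kact /coord mulr_sumr -sumrB; apply: eq_bigr => x _.
by rewrite /kshift mulrBl mulrA.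
Qed.

(* Every eigen-component of f that does not vanish is obtained from f by
   applying shifts of the kernel, hence lies in any shift-stable class. *)
Lemma rayleigh_bound (V : (Y -> R) -> Prop) (theta : R) :
  (forall lam f, V f -> V (kshift lam f)) ->
  (forall f lam, V f -> (exists2 x, x \in D & f x != 0) ->
     {in D, forall x, kact f x = lam * f x} -> lam <= theta) ->
  forall f, V f ->
    \sum_(x in D) f x * kact f x <= theta * \sum_(x in D) f x ^+ 2.
Proof.
move=> Vshift Veig f Vf; rewrite kact_form.
under [X in _ <= _ * X]eq_bigr do rewrite expr2.
rewrite parseval mulr_sumr; apply: ler_sum => m _.
have [->|cm] := eqVneq (coord m f) 0; first by rewrite expr2 !(mulr0, mul0r).
rewrite -expr2; apply: ler_wpM2r; first exact: sqr_ge0.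
pose s := [seq d m' | m' <- enum 'I_#|D| & d m' != d m].
pose f' := foldr kshift f s.
have Vf' : V f' by rewrite /f'; elim: (s) => //= lam s1 IH; exact: Vshift.
have cf' m' : coord m' f' = (\prod_(lam <- s) (d m' - lam)) * coord m' f.
  rewrite /f'; elim: (s) => /= [|lam s1 IH]; first by rewrite big_nil mul1r.
  by rewrite coord_kshift IH big_cons mulrA.
have cf'0 m' : d m' != d m -> coord m' f' = 0.
  move=> m'm; rewrite cf' (big_rem (d m')) /=; last first.
    by apply/mapP; exists m' => //; rewrite mem_filter m'm mem_enum.
  by rewrite subrr !mul0r.
have cf'm : coord m f' != 0.
  rewrite cf' mulf_neq0 // prodf_seq_neq0; apply/allP => _ /mapP[m' + ->] /=.
  by rewrite mem_filter subr_eq0 eq_sym => /andP[].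
apply: (Veig _ _ Vf').
  apply/exists_inP; apply: contraT; rewrite negb_exists_in => /forall_inP f'0.
  case/negP: cf'm; rewrite /coord big1 // => x /f'0 /negPn /eqP ->.
  by rewrite mul0r.
have [_ _ eig] := ed; move=> x xD.
rewrite (coord_expand (kact f') xD) (coord_expand f' xD) mulr_sumr.
apply: eq_bigr => m' _; rewrite coord_kact mulrA.
by have [->//|/cf'0 ->] := eqVneq (d m') (d m); rewrite !mulr0.
Qed.

(** Courant-Fischer by a dimension count: more than [#|G|] eigenvectors above [theta] would span a
    nonzero [f] orthogonal to every [phi g], and its Rayleigh quotient would exceed [theta]. *)
Lemma card_large_eigenvalues (I : finType) (G : {set I}) (phi : I -> Y -> R)
    (theta : R) :
  (forall f, (forall g, g \in G -> \sum_(x in D) f x * phi g x = 0) ->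
     \sum_(x in D) f x * kact f x <= theta * \sum_(x in D) f x ^+ 2) ->
  (#|[set m | (theta < d m)%R]| <= #|G|)%N.
Proof.
move=> Gform; set S := [set m | theta < d m]; rewrite leqNgt; apply/negP => GS.
pose B : 'M[R]_(#|S|, #|G|) :=
  \matrix_(i, j) \sum_(x in D) e (enum_val i) x * phi (enum_val j) x.
have : kermx B != 0.
  rewrite -mxrank_eq0 mxrank_ker subn_eq0 -ltnNge.
  by rewrite (leq_ltn_trans (rank_leq_col B)).
case/rowV0Pn => c /sub_kermxP cB c0.
pose f x := \sum_i c 0 i * e (enum_val i) x.
have fG g : g \in G -> \sum_(x in D) f x * phi g x = 0.
  move=> gG; rewrite -(enum_rankK_in gG gG); set j := enum_rank_in _ _.
  have /rowP/(_ j) := cB; rewrite [X in X = _ -> _]mxE [X in _ = X -> _]mxE => cB0.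
  rewrite -[RHS]cB0.
  under [LHS]eq_bigr do rewrite /f mulr_suml.
  rewrite exchange_big /=; apply: eq_bigr => i _.
  by rewrite mxE mulr_sumr; apply: eq_bigr => x _; rewrite mulrA.
have [_ orth _] := ed.
have cf m : coord m f = \sum_i c 0 i * (enum_val i == m)%:R.
  rewrite /coord; under eq_bigr do rewrite mulr_suml.
  rewrite exchange_big /=; apply: eq_bigr => i _.
  by under eq_bigr do rewrite -mulrA; rewrite -mulr_sumr orth.
have cfS i : coord (enum_val i) f = c 0 i.
  rewrite cf (bigD1 i) //= eqxx mulr1 big1 ?addr0 // => j ji.
  by rewrite (inj_eq enum_val_inj) (negbTE ji) mulr0.
have cfN m : m \notin S -> coord m f = 0.
  move=> mS; rewrite cf big1 // => i _; case: eqP => [im|]; last by rewrite mulr0.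
  by move: mS; rewrite -im enum_valP.
have := Gform f fG; rewrite kact_form.
under [X in _ <= _ * X]eq_bigr do rewrite expr2.
rewrite parseval mulr_sumr leNgt => /negP; apply.
have [i ci] : exists i, c 0 i != 0.
  apply/existsP; apply: contraT; rewrite negb_exists => /forallP c00.
  by case/eqP: c0; apply/rowP => i; rewrite mxE; apply/eqP/negPn/c00.
have iS : theta < d (enum_val i) by have := enum_valP i; rewrite inE.
rewrite (bigD1 (enum_val i)) //= [ltRHS](bigD1 (enum_val i)) //= cfS -expr2.
apply: ltr_leD; first by rewrite ltr_pM2r // lt_def sqr_ge0 sqrf_eq0 ci.
apply: ler_sum => m _; have [mS|mS] := boolP (m \in S); last first.
  by rewrite cfN // expr2 !mulr0.
by rewrite -expr2 ler_wpM2r ?sqr_ge0 //; move: mS; rewrite inE => /ltW.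
Qed.
End SymmetricKernel.

(** * Perfect matchings *)

Lemma setD_sub_self (S : finType) (X Y : {set S}) : X \subset Y -> Y :\: (Y :\: X) = X.
Proof. by move=> XY; rewrite setDDr setDv set0U; apply/setIidPr. Qed.

Lemma setUD_sub (S : finType) (X Y : {set S}) : X \subset Y -> X :|: Y :\: X = Y.
Proof. by move=> XY; rewrite setDE setUIr setUCr setIT; apply/setUidPr. Qed.

Section Matchings.
Context (T : finType).
Implicit Types (A B C U W e : {set T}) (M N F G H : {set {set T}}).
Local Notation pm := perfect_matchings.

Lemma pmP M A : reflect [/\ cover M = A, trivIset M & {in M, forall e, #|e| = 2}]
  (M \in pm A).
Proof.
rewrite inE; apply: (iffP andP) => [[/and3P[/eqP cM tM _] /forall_inP M2]|[cM tM M2]].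
  by split=> // e /M2/eqP.
split; last by apply/forall_inP => e /M2 ->.
apply/and3P; split=> //; first exact/eqP.
by apply/negP => /M2; rewrite cards0.
Qed.

Lemma pm_cover M A : M \in pm A -> cover M = A.
Proof. by case/pmP. Qed.

Lemma pm_card2 M A e : M \in pm A -> e \in M -> #|e| = 2.
Proof. by case/pmP => _ _ M2 /M2. Qed.

Lemma pm_edge_sub M A e : M \in pm A -> e \in M -> e \subset A.
Proof. by case/pmP => <- _ _ eM; exact: bigcup_sup. Qed.

Lemma pm_edge_uniq M A e e' x :
  M \in pm A -> e \in M -> e' \in M -> x \in e -> x \in e' -> e = e'.
Proof.
case/pmP => _ /trivIsetP tM _ eM e'M xe xe'; apply/eqP/negPn/negP => ee'.
by have /disjoint_setI0/setP/(_ x) := tM _ _ eM e'M ee'; rewrite !inE xe xe'.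
Qed.

Lemma pm_edge M A x : M \in pm A -> x \in A -> exists2 e, e \in M & x \in e.
Proof. by case/pmP => <- _ _ /bigcupP[e eM xe]; exists e. Qed.

Lemma pm_edge_ex M A e : M \in pm A -> e \in M -> exists x, x \in e.
Proof.
move=> MA eM; apply/set0Pn; rewrite -card_gt0.
by rewrite (pm_card2 MA eM).
Qed.

Lemma pm_card M A : M \in pm A -> #|A| = (2 * #|M|)%N.
Proof.
case/pmP => <- tM M2; rewrite -(eqP tM) (eq_bigr (fun=> 2%N)) => [|e /M2//].
by rewrite sum_nat_const mulnC.
Qed.

Lemma pm_sub M A G : M \in pm A -> G \subset M -> G \in pm (cover G).
Proof.
case/pmP => _ tM M2 GM; apply/pmP; split=> //; first exact: trivIsetS tM.
by move=> e /(subsetP GM)/M2.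
Qed.

Lemma pm_cover_sub M A G : M \in pm A -> G \subset M -> cover G \subset A.
Proof.
move=> MA /subsetP GM; apply/bigcupsP => e /GM; exact: pm_edge_sub.
Qed.

Lemma pm_disj G B N C :
  G \in pm B -> N \in pm C -> [disjoint B & C] -> [disjoint G & N].
Proof.
move=> GB NC; rewrite -!setI_eq0 => /eqP dBC; apply/eqP/setP => e; rewrite !inE.
apply/negP => /andP[eG eN]; have [x xe] := pm_edge_ex GB eG.
have /setP/(_ x) := dBC; rewrite !inE.
by rewrite (subsetP (pm_edge_sub GB eG)) // (subsetP (pm_edge_sub NC eN)).
Qed.

Lemma pmU G B N C :
  G \in pm B -> N \in pm C -> [disjoint B & C] -> G :|: N \in pm (B :|: C).
Proof.
move=> GB NC dBC; apply/pmP; split.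
- rewrite /cover bigcup_setU -!/(cover _).
  by rewrite (pm_cover GB) (pm_cover NC).
- have dis e e' x : e \in G -> e' \in N -> x \in e -> x \in e' -> False.
    move=> eG e'N xe xe'; move: dBC; rewrite -setI_eq0 => /eqP/setP/(_ x).
    rewrite !inE (subsetP (pm_edge_sub GB eG)) //.
    by rewrite (subsetP (pm_edge_sub NC e'N)).
  apply/trivIsetP => e e' eM e'M ee'; rewrite -setI_eq0.
  apply/eqP/setP => x; rewrite !inE; apply/negP => /andP[xe xe'].
  case/setUP: eM => eM; case/setUP: e'M => e'M; try exact: dis xe xe';
    try exact: dis xe' xe.
  + by case/eqP: ee'; exact: (pm_edge_uniq GB) xe xe'.
  + by case/eqP: ee'; exact: (pm_edge_uniq NC) xe xe'.
- by move=> e /setUP[]; [exact: pm_card2 GB|exact: pm_card2 NC].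
Qed.

Lemma pmD M A G B : M \in pm A -> G \in pm B -> G \subset M -> M :\: G \in pm (A :\: B).
Proof.
move=> MA GB GM; apply/pmP; split.
- apply/setP => x; rewrite inE; apply/bigcupP/andP => [[e]|[xB xA]].
    rewrite inE => /andP[eG eM] xe; split; last first.
      by rewrite (subsetP (pm_edge_sub MA eM)).
    apply: contra eG => /(pm_edge GB)[e' e'G xe'].
    by rewrite (pm_edge_uniq MA eM (subsetP GM _ e'G) xe xe').
  have [e eM xe] := pm_edge MA xA; exists e; rewrite // inE eM andbT.
  by apply: contra xB => eG; rewrite (subsetP (pm_edge_sub GB eG)).
- by case/pmP: MA => _ + _; apply: trivIsetS; exact: subsetDl.
- by move=> e /setDP[eM _]; exact: (pm_card2 MA).
Qed.

(** Deleting [G] is a bijection onto the matchings of the points that [G] leaves free. *)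
Lemma big_pm_ext (R : Type) (idx : R) (op : Monoid.com_law idx) G A B
    (phi : {set {set T}} -> R) :
  G \in pm B -> B \subset A ->
  \big[op/idx]_(M in pm A | G \subset M) phi M
    = \big[op/idx]_(N in pm (A :\: B)) phi (G :|: N).
Proof.
move=> GB BA; rewrite (reindex_onto (fun N => G :|: N) (fun M => M :\: G)) /=.
  apply: eq_bigl => N; rewrite subsetUl andbT.
  apply/andP/idP => [[MA /eqP <-]|NA].
    exact: pmD MA GB (subsetUl _ _).
  have dB : [disjoint B & A :\: B] by rewrite disjoints_subset setCD subsetUr.
  rewrite -(setUD_sub BA).
  split; first exact: pmU.
  rewrite setDUl setDv set0U; apply/eqP/setDidPl; rewrite disjoint_sym.
  exact: pm_disj dB.
by move=> M /andP[_ GM]; exact: setUD_sub.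
Qed.

End Matchings.

(** * Counting perfect matchings *)

Lemma card_between (S : finType) (A B : {set S}) (j : nat) :
  A \subset B -> (#|A| <= j)%N ->
  #|[set X : {set S} | [&& A \subset X, X \subset B & #|X| == j]]|
    = 'C(#|B| - #|A|, j - #|A|).
Proof.
move=> AB Aj; rewrite -cardsDS // -cards_draws.
rewrite -[RHS](@card_in_imset _ _ (fun X => A :|: X)); last first.
  move=> X Y; rewrite !inE  !subsetD => /andP[/andP[_ XA] _] /andP[/andP[_ YA] _].
  move=> /(congr1 (fun Z => Z :\: A)); rewrite !setDUl !setDv !set0U.
  by rewrite (setDidPl XA) (setDidPl YA).
apply: eq_card => X; rewrite !inE; apply/and3P/imsetP => [[AX XB /eqP Xj]|[Y]].
  exists (X :\: A); last by rewrite setUD_sub.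
  by rewrite inE setSD //= cardsDS // Xj.
rewrite inE subsetD => /andP[/andP[YB YA] /eqP Yj] ->.
rewrite subsetUl subUset AB YB; split=> //.
by rewrite cardsU disjoint_setI0 1?disjoint_sym // cards0 subn0 Yj subnKC.
Qed.

(** The double factorial (2n - 1)!!, which counts the perfect matchings of 2n points. *)
Fixpoint odd_fact (n : nat) : nat :=
  if n is m.+1 then (m.*2.+1 * odd_fact m)%N else 1%N.

Lemma odd_fact_gt0 n : (0 < odd_fact n)%N.
Proof. by elim: n => //= n IH; rewrite muln_gt0. Qed.

Section Counting.
Context (T : finType).
Implicit Types (A B C U W e : {set T}) (M N F G H : {set {set T}}).
Local Notation pm := perfect_matchings.

Lemma pm_set0 : pm (@set0 T) = [set set0].
Proof.
apply/setP => M; rewrite in_set1; apply/pmP/eqP => [[cM _ M2]|->].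
  apply/eqP; rewrite -subset0; apply/subsetP => e eM.
  have := M2 _ eM; suff -> : e = set0 by rewrite cards0.
  by apply/eqP; rewrite -subset0 -cM; exact: bigcup_sup.
split; first by rewrite /cover big_set0.
  by apply/trivIsetP => e; rewrite inE.
by move=> e; rewrite inE.
Qed.

Lemma pm_pair (a b : T) : b != a ->
  [set [set a; b]] \in pm [set a; b].
Proof.
move=> ba; apply/pmP; split.
- by rewrite /cover big_set1.
- by apply/trivIsetP => e e'; rewrite !inE => /eqP -> /eqP ->; rewrite eqxx.
- by move=> e; rewrite inE => /eqP ->; rewrite cards2 eq_sym ba.
Qed.

Lemma pm_partner M A a : M \in pm A -> a \in A ->
  #|[set b in A :\ a | [set a; b] \in M]| = 1%N.
Proof.
move=> MA aA; have [e eM ae] := pm_edge MA aA.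
have e2 := pm_card2 MA eM.
suff -> : [set b in A :\ a | [set a; b] \in M] = e :\ a.
  by have := cardsD1 a e; rewrite e2 ae => -[].
apply/setP => b; rewrite !inE; case: eqVneq => //= ba.
apply/andP/idP => [[_ abM]|be].
  by rewrite (pm_edge_uniq MA eM abM ae) !inE eqxx // orbT.
split; first by rewrite (subsetP (pm_edge_sub MA eM)).
suff -> : [set a; b] = e by [].
by apply/eqP; rewrite eqEcard e2 cards2 eq_sym ba subUset !sub1set ae be.
Qed.

(** The matchings are sorted by the partner of one fixed point. *)
Lemma card_pm n A : #|A| = (2 * n)%N -> #|pm A| = odd_fact n.
Proof.
elim: n A => [|n IH] A.
  by move=> /eqP; rewrite muln0 cards_eq0 => /eqP ->; rewrite pm_set0 cards1.
move=> cA; have [a aA] : exists a, a \in A.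
  by apply/set0Pn; rewrite -card_gt0 cA.
have -> : #|pm A| = (\sum_(M in pm A) \sum_(b in A :\ a | [set a; b] \in M) 1)%N.
  rewrite -sum1_card; apply: eq_bigr => M MA.
  by rewrite sum1dep_card (pm_partner MA aA).
rewrite (exchange_big_dep (mem (A :\ a))) //=; last by move=> M b _ /andP[].
rewrite (eq_bigr (fun=> odd_fact n)) => [|b]; last first.
  rewrite !inE => /andP[ba bA].
  transitivity (\sum_(M in pm A | [set [set a; b]] \subset M) 1)%N.
    by apply: eq_bigl => M; rewrite sub1set ba bA.
  have abA : [set a; b] \subset A by rewrite subUset !sub1set aA bA.
  rewrite (@big_pm_ext _ _ _ addn _ _ _ _ (pm_pair ba) abA) sum1_card IH //.
  by rewrite cardsDS // cards2 eq_sym ba cA; lia.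
rewrite sum_nat_const; have := cardsD1 a A; rewrite aA cA => h.
by congr (_ * _)%N; lia.
Qed.

Lemma card_pm_ext A M0 G n : M0 \in pm A -> G \subset M0 -> #|A| = (2 * n)%N ->
  #|[set M in pm A | G \subset M]| = odd_fact (n - #|G|).
Proof.
move=> M0A GM0 cA; have GB := pm_sub M0A GM0.
rewrite -sum1dep_card (@big_pm_ext _ _ _ addn _ _ _ _ GB (pm_cover_sub M0A GM0)).
rewrite sum1_card; apply: card_pm.
rewrite cardsDS ?(pm_cover_sub M0A GM0) // cA (pm_card GB); lia.
Qed.

Lemma pm_extend B N A : N \in pm B -> B \subset A -> forall n, #|A| = (2 * n)%N ->
  exists2 M, M \in pm A & N \subset M.
Proof.
move=> NB BA n cA.
have : (0 < #|pm (A :\: B)|)%N.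
  rewrite (@card_pm (n - #|N|)) ?odd_fact_gt0 //.
  by rewrite cardsDS // cA (pm_card NB); lia.
case/card_gt0P => M MAB; exists (N :|: M); last exact: subsetUl.
rewrite -(setUD_sub BA).
by apply: pmU => //; rewrite disjoints_subset setCD subsetUr.
Qed.

End Counting.

(** * Sums over the matchings containing a partial matching *)

Section Hat.
Context (T : finType) (R : rcfType).
Implicit Types (A B C U W e : {set T}) (M N F G H : {set {set T}}).
Implicit Types (f u : {set {set T}} -> R).
Local Notation pm := perfect_matchings.

Definition hat f A G : R := \sum_(M in pm A | G \subset M) f M.

(** The number of common sets of [d] pairs. For [d = n - k] it is the transition matrix up to a
    constant: the common set is the set of unbroken pairs. *)
Definition overlap (d : nat) M N : R := 'C(#|M :&: N|, d)%:R.

(** The quadratic form of [overlap d], by [qformE]. Being a sum of squares, it makes all eigenvalues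
    of the walk nonnegative. *)
Definition qform A (d : nat) f : R := \sum_(G : {set {set T}} | #|G| == d) hat f A G ^+ 2.

Lemma overlap_sym d M N : overlap d M N = overlap d N M.
Proof. by rewrite /overlap setIC. Qed.

Lemma kact_overlap A d f M :
  kact (pm A) (overlap d) f M
    = \sum_(G : {set {set T}} | (G \subset M) && (#|G| == d)) hat f A G.
Proof.
rewrite /kact /hat /overlap.
rewrite (exchange_big_dep (mem (pm A))) /=; last by move=> G N _ /andP[].
apply: eq_bigr => N NA; rewrite -cards_draws mulrC mulr_natr.
rewrite -sumr_const; apply: eq_bigl => G; rewrite inE NA subsetI /=.
by case: (G \subset M); case: (G \subset N); rewrite ?andbT ?andbF.
Qed.

Lemma qformE A d f :
  \sum_(M in pm A) f M * kact (pm A) (overlap d) f M = qform A d f.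
Proof.
under eq_bigr do rewrite kact_overlap mulr_sumr.
rewrite (exchange_big_dep (fun G : {set {set T}} => #|G| == d)) /=; last first.
  by move=> M G _ /andP[].
apply: eq_bigr => G Gd; rewrite expr2 {1}/hat mulr_suml.
by apply: eq_bigl => M; rewrite Gd andbT.
Qed.

Lemma hat0_out f A G : (forall M, M \in pm A -> ~~ (G \subset M)) -> hat f A G = 0.
Proof.
move=> h; rewrite /hat big_pred0 // => M; apply/negbTE/negP => /andP[/h] + GM.
by rewrite GM.
Qed.

Lemma pm_inj_sub A M N : M \in pm A -> N \in pm A -> M \subset N -> M = N.
Proof.
move=> MA NA MN; apply/eqP; rewrite eqEcard MN /=.
by rewrite -(leq_pmul2l (isT : 0 < 2)%N) -(pm_card NA) -(pm_card MA).
Qed.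

Lemma hat_full f A M : M \in pm A -> hat f A M = f M.
Proof.
move=> MA; rewrite /hat (bigD1 M) ?MA ?subxx //= big1 ?addr0 // => N.
by move=> /andP[/andP[NA MN]]; rewrite (pm_inj_sub MA NA MN) eqxx.
Qed.

(** Double counting: summing [hat f A] over the sets of [j] pairs that contain [G] gives a positive
    multiple of [hat f A G]. Vanishing at one level thus forces vanishing at all lower ones. *)
Lemma hat_level f A n j G : #|A| = (2 * n)%N -> (#|G| <= j <= n)%N ->
  (forall G', #|G'| = j -> hat f A G' = 0) -> hat f A G = 0.
Proof.
move=> cA /andP[Gj jn] h.
have : 'C(n - #|G|, j - #|G|)%:R * hat f A G = 0.
  rewrite -[RHS](@big1 _ _ +%R _ (index_enum {set {set T}})
    (fun G' : {set {set T}} => (G \subset G') && (#|G'| == j)) (fun G' => hat f A G')).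
    rewrite /hat mulr_sumr (exchange_big_dep (mem (pm A))) /=; last by move=> G' N _ /andP[].
    rewrite [RHS](bigID (fun N : {set {set T}} => G \subset N)) /=.
    rewrite [X in _ + X]big1 ?addr0.
      apply: eq_bigr => M /andP[MA GM]; rewrite mulrC mulr_natr.
      have -> : n = #|M| by have := pm_card MA; rewrite cA; lia.
      rewrite -card_between // -sumr_const; apply: eq_bigl => G'.
      by rewrite inE MA /= [X in _ = X]andbAC -andbA.
    move=> M /andP[_ GM]; rewrite big_pred0 // => G'.
    apply/negbTE; apply: contra GM => /andP[/andP[GG' _] /andP[_ G'M]].
    exact: subset_trans G'M.
  by move=> G' /andP[_ /eqP]; exact: h.
move/eqP; rewrite mulf_eq0 pnatr_eq0 => /orP[|/eqP//].
by rewrite -leqn0 leqNgt bin_gt0; case/negP; lia.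
Qed.

End Hat.

(** * Common extensions of two partial matchings *)

Section Overlaps.
Context (T : finType).
Implicit Types (A B C U W e : {set T}) (M N F G H Q : {set {set T}}).
Local Notation pm := perfect_matchings.

Definition avoiding M U : {set {set T}} := [set e in M | [disjoint e & U]].
Definition within M U : {set {set T}} := [set e in M | e \subset U].

Lemma pm_edge_card M A x : M \in pm A -> x \in A -> #|[set e in M | x \in e]| = 1%N.
Proof.
move=> MA xA; have [e eM xe] := pm_edge MA xA.
rewrite (_ : [set _ in _ | _] = [set e]) ?cards1 //; apply/setP => e'; rewrite !inE.
apply/andP/eqP => [[e'M xe']|->]; last by [].
exact: pm_edge_uniq MA e'M eM xe' xe.
Qed.

(* An edge of M inside U covers two points of U, an edge leaving U only one. *)
Lemma card_avoiding M A U : M \in pm A -> U \subset A ->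
  (#|U| + #|avoiding M U| = #|M| + #|within M U|)%N.
Proof.
move=> MA UA.
have -> : #|U| = (\sum_(e in M) #|e :&: U|)%N.
  transitivity (\sum_(e in M) \sum_(x in U | x \in e) 1)%N; last first.
    apply: eq_bigr => e _; rewrite -sum1_card; apply: eq_bigl => x.
    by rewrite inE andbC.
  rewrite (exchange_big_dep (mem U)) /=; last by move=> e x _ /andP[].
  rewrite -sum1_card; apply: eq_bigr => x xU.
  rewrite -[LHS](pm_edge_card MA (subsetP UA x xU)) -sum1dep_card.
  by apply: eq_bigl => e; rewrite xU.
rewrite -[#|avoiding _ _|]sum1dep_card -[#|within _ _|]sum1dep_card -[#|M|]sum1_card.
rewrite !big_mkcondr -!big_split /=; apply: eq_bigr => e eM.
have e2 := pm_card2 MA eM.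
have h := cardsID U e; rewrite e2 in h.
have [eU|eU] := boolP (e \subset U).
  rewrite (setIidPl eU) e2; case: ifP => // dU.
  have [x xe] := pm_edge_ex MA eM.
  by have := disjointFr dU xe; rewrite (subsetP eU).
case: ifP => dU; first by rewrite disjoint_setI0 // cards0.
have : (0 < #|e :\: U|)%N by rewrite card_gt0 setD_eq0.
have : (0 < #|e :&: U|)%N by rewrite card_gt0 setI_eq0 dU.
lia.
Qed.

Lemma card_within M A U i : M \in pm A -> #|U| = (2 * i)%N -> (#|within M U| <= i)%N.
Proof.
move=> MA cU; rewrite -(leq_pmul2l (isT : 0 < 2)%N) -cU.
have WM : within M U \subset M by apply/subsetP => e; rewrite inE => /andP[].
rewrite -(pm_card (pm_sub MA WM)); apply/subset_leq_card/bigcupsP => e.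
by rewrite inE => /andP[].
Qed.

Lemma within_pm M A U Q i : M \in pm A -> #|U| = (2 * i)%N ->
  (Q \subset within M U) && (#|Q| == i) = (Q \in pm U) && (Q \subset M).
Proof.
move=> MA cU; apply/andP/andP => [[QW /eqP Qi]|[QU QM]].
  have QM : Q \subset M.
    by apply: subset_trans QW _; apply/subsetP => e; rewrite inE => /andP[].
  have Qc := pm_sub MA QM; split=> //; suff <- : cover Q = U by [].
  apply/eqP; rewrite eqEcard (pm_card Qc) Qi cU leqnn andbT.
  by apply/bigcupsP => e /(subsetP QW); rewrite inE => /andP[].
split; last by rewrite -(eqn_pmul2l (isT : 0 < 2)%N) -(pm_card QU) cU.
by apply/subsetP => e eQ; rewrite inE (subsetP QM) // (pm_edge_sub QU).
Qed.

(** Only [H = F :\: G] can contribute, and it does so exactly when [F] and [G] are compatible. The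
    sum form lets [G] be summed out for fixed [H] afterwards. *)
Lemma card_common_ext A n k F G M' :
  #|A| = (2 * n)%N -> (k <= n)%N -> cover F \subset A -> F \in pm (cover F) ->
  M' \in pm A -> G \subset M' -> #|G| = (n - k)%N ->
  #|[set M in pm A | (F \subset M) && (G \subset M)]| =
  (\sum_(H : {set {set T}} | (H \subset F) && (#|H| <= k))
     odd_fact (k - #|H|) * ((F :\: H \subset G) && (G \subset avoiding M' (cover H))))%N.
Proof.
move=> cA kn FA Fpm M'A GM' cG.
have edgeG e : e \in G -> exists x, x \in e.
  by move=> eG; exact: pm_edge_ex M'A (subsetP GM' _ eG).
have Gpm := pm_sub M'A GM'.
pose H0 := F :\: G.
have H0F : H0 \subset F := subsetDl _ _.
have H0pm := pm_sub Fpm H0F.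
have only H : H \subset F -> F :\: H \subset G -> G \subset avoiding M' (cover H) -> H = H0.
  move=> HF FHG GH; apply/eqP; rewrite eqEsubset; apply/andP; split.
    apply/subsetP => e eH; rewrite inE (subsetP HF) // andbT.
    apply/negP => eG; have [x xe] := edgeG _ eG.
    have := subsetP GH _ eG; rewrite inE => /andP[_ /disjointFr/(_ xe)].
    by rewrite (subsetP (bigcup_sup _ eH)).
  apply/subsetP => e; rewrite inE => /andP[eG eF]; apply: contraNT eG => eH.
  by apply: (subsetP FHG); rewrite inE eH.
have FH0 : F :\: H0 \subset G by rewrite setDDr setDv set0U subsetIr.
have [GH|GH] := boolP (G \subset avoiding M' (cover H0)); last first.
  rewrite big1 => [|H /andP[HF _]]; last first.
    case: andP => [[FHG GHa]|]; rewrite ?muln0 //.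
    by case/negP: GH; rewrite -(only H).
  apply: eq_card0 => M; rewrite inE; apply/negP => /and3P[MA FM GM].
  case/negP: GH; apply/subsetP => e eG; rewrite inE (subsetP GM') //=.
  rewrite -setI_eq0; apply/eqP/setP => x; rewrite !inE; apply/negP => /andP[xe].
  case/bigcupP => e'; rewrite inE => /andP[e'G e'F] xe'; case/negP: e'G.
  by rewrite -(pm_edge_uniq MA (subsetP GM _ eG) (subsetP FM _ e'F) xe xe').
have dGH : [disjoint cover H0 & cover G].
  rewrite disjoint_sym -setI_eq0; apply/eqP/setP => x; rewrite !inE.
  apply/negP => /andP[/bigcupP[e /(subsetP GH)]].
  by rewrite inE => /andP[_ /disjointFr h /h ->].
have Upm := pmU H0pm Gpm dGH.
have UA : cover H0 :|: cover G \subset A.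
  rewrite subUset (pm_cover_sub M'A GM') andbT.
  exact: subset_trans (pm_cover_sub Fpm H0F) FA.
have [M MA UM] := pm_extend Upm UA cA.
have cU : (#|H0 :|: G| = #|H0| + (n - k))%N.
  rewrite cardsU (_ : H0 :&: G = set0) ?cards0 ?subn0 ?cG //.
  by apply/setP => e; rewrite !inE; case: (e \in G); rewrite ?andbF.
have H0k : (#|H0| <= k)%N.
  have := subset_leq_card UM; rewrite cU.
  have := pm_card MA; rewrite cA; clear -kn; lia.
have -> : [set M in pm A | (F \subset M) && (G \subset M)]
        = [set M in pm A | H0 :|: G \subset M].
  apply/setP => N; rewrite !inE; congr (_ && _); rewrite subUset.
  have [GN|] := boolP (G \subset N); last by rewrite !andbF.
  rewrite !andbT; apply/idP/idP => [|H0N]; first exact: subset_trans.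
  apply/subsetP => e eF; have [eG|eG] := boolP (e \in G); first exact: (subsetP GN).
  by apply: (subsetP H0N); rewrite inE eG.
rewrite (card_pm_ext MA UM cA) cU (bigD1 H0) ?H0F ?H0k //= FH0 GH muln1.
rewrite big1 ?addn0 => [|H /andP[/andP[HF _] HH0]]; first by congr odd_fact; clear -kn H0k; lia.
case: andP => [[FHG GHa]|]; rewrite ?muln0 //.
by case/negP: HH0; rewrite (only H).
Qed.

Lemma sum_card_common_ext A n k F M' j l :
  #|A| = (2 * n)%N -> n = (j + l)%N -> (k <= l)%N -> cover F \subset A ->
  F \in pm (cover F) -> #|F| = j -> M' \in pm A ->
  (\sum_(G : {set {set T}} | (G \subset M') && (#|G| == n - k))
     #|[set M in pm A | (F \subset M) && (G \subset M)]| =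
   \sum_(H : {set {set T}} | (H \subset F) && (#|H| <= k)%N)
     odd_fact (k - #|H|) * ((F :\: H \subset M') *
        'C(l - #|H| + #|within M' (cover H)|, l - k + #|H|)))%N.
Proof.
move=> cA nE kl FA Fpm cF M'A.
have kn : (k <= n)%N by lia.
under eq_bigr => G /andP[GM' /eqP cG].
  rewrite (card_common_ext cA kn FA Fpm M'A GM' cG); over.
rewrite exchange_big /=; apply: eq_bigr => H /andP[HF Hk].
rewrite -big_distrr /=; congr (_ * _)%N.
have HM e e' x : e \in F -> e' \in F -> x \in e -> x \in e' -> e = e'.
  exact: pm_edge_uniq Fpm.
have cFH : #|F :\: H| = (j - #|H|)%N by rewrite cardsDS // cF.
have Hj : (#|H| <= j)%N by rewrite -cF subset_leq_card.
have UA := subset_trans (pm_cover_sub Fpm HF) FA.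
have cU : #|cover H| = (2 * #|H|)%N := pm_card (pm_sub Fpm HF).
have [FHM|FHM] := boolP (F :\: H \subset M'); last first.
  rewrite mul0n big1 // => G /andP[GM' _]; case: andP => // -[FHG _].
  by case/negP: FHM; exact: subset_trans GM'.
rewrite mul1n.
have FHa : F :\: H \subset avoiding M' (cover H).
  apply/subsetP => e eFH; rewrite inE (subsetP FHM) //=.
  move: eFH; rewrite inE => /andP[eH eF].
  rewrite -setI_eq0; apply/eqP/setP => x; rewrite !inE; apply/negP => /andP[xe].
  case/bigcupP => e' e'H xe'; case/negP: eH.
  by rewrite (HM _ _ _ eF (subsetP HF _ e'H) xe xe').
have aM : avoiding M' (cover H) \subset M'.
  by apply/subsetP => e; rewrite inE => /andP[].
transitivity #|[set G : {set {set T}} | [&& F :\: H \subset G,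
     G \subset avoiding M' (cover H) & #|G| == n - k]]|%N.
  rewrite -sum1dep_card big_mkcond [RHS]big_mkcond; apply: eq_bigr => G _ /=.
  have [Ga|] := boolP (G \subset avoiding _ _); last by rewrite !andbF; case: ifP.
  by rewrite (subset_trans Ga aM) andbT /=; case: (F :\: H \subset G); case: (_ == _).
(* By [k <= l], [j - #|H| <= n - k]: a set of [n - k] pairs has room for [F :\: H]. *)
rewrite card_between //; last by rewrite cFH; clear -nE kl Hj; lia.
have := card_avoiding M'A UA; rewrite cU cFH.
have := pm_card M'A; rewrite cA => hM' hav.
have := leq_trans Hk kl; move: hM' hav Hj; clear -nE kl.
move: #|avoiding _ _| #|within _ _| #|H| #|M'| => a r h m hM' hav Hj hl.
by congr 'C(_, _); lia.
Qed.

End Overlaps.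

(** * The action of the walk on [hat f] *)

Section Intertwining.
Context (T : finType) (R : rcfType).
Implicit Types (A B C U W e : {set T}) (M N F G H Q : {set {set T}}).
Implicit Types (f u : {set {set T}} -> R).
Local Notation pm := perfect_matchings.

(** The binomial coefficient counts the sets of [s] pairs of [M] inside [U]. For [s < h] they lead
    to values of [hat f A] below the first visible level, for [s > h] there are none, and for
    [s = h] they are perfect matchings of [U]. *)
Lemma sum_bin_within A f (F2 : {set {set T}}) U h s :
  #|U| = (2 * h)%N ->
  (forall G, (#|G| < #|F2| + h)%N -> hat f A G = 0) ->
  \sum_(M in pm A | F2 \subset M) f M * 'C(#|within M U|, s)%:R
    = if s == h then \sum_(Q in pm U) hat f A (F2 :|: Q) else 0.
Proof.
move=> cU f0.
have common P : (forall M Q, M \in pm A ->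
      (Q \subset within M U) && (#|Q| == s) = P Q && (Q \subset M)) ->
    \sum_(M in pm A | F2 \subset M) f M * 'C(#|within M U|, s)%:R
      = \sum_(Q | P Q) hat f A (F2 :|: Q).
  move=> hP.
  under eq_bigr => M /andP[MA _].
    rewrite -cards_draws mulr_natr -sumr_const.
    under eq_bigl do rewrite inE hP //.
    over.
  rewrite (exchange_big_dep P) /=; last by move=> M Q _ /andP[].
  apply: eq_bigr => Q PQ; apply: eq_bigl => M.
  by rewrite PQ subUset /= andbA.
case: (ltngtP s h) => [sh|hs|sh].
- rewrite (common (fun Q => (Q \subset powerset U) && (#|Q| == s))).
    apply: big1 => Q /andP[_ /eqP cQ]; apply: f0.
    by rewrite (leq_ltn_trans (leq_card_setU _ _)) // cQ ltn_add2l.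
  move=> M Q MA; rewrite andbAC; congr (_ && _).
  apply/subsetP/andP => [QW|[/subsetP QU /subsetP QM] e eQ].
    by split; apply/subsetP => e /QW; rewrite !inE => /andP[].
  by have := QU _ eQ; rewrite !inE QM.
- apply: big1 => M /andP[MA _]; rewrite bin_small ?mulr0 //.
  exact: leq_ltn_trans (card_within MA cU) hs.
- by apply: (common (fun Q => Q \in pm U)) => M Q MA; rewrite sh; exact: within_pm MA cU.
Qed.

Lemma sum_vandermonde A f j l k W F H :
  (k <= l)%N ->
  (forall G, (#|G| < j)%N -> hat f A G = 0) -> F \in pm W -> #|F| = j ->
  H \subset F -> (#|H| <= k)%N ->
  \sum_(M in pm A | F :\: H \subset M)
     f M * 'C(l - #|H| + #|within M (cover H)|, l - k + #|H|)%:R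
   = 'C(l - #|H|, k - #|H|)%:R * hat (hat f A) W (F :\: H).
Proof.
move=> kl f0 FW cF HF Hk.
have Hj : (#|H| <= j)%N by rewrite -cF subset_leq_card.
have cFH : #|F :\: H| = (j - #|H|)%N by rewrite cardsDS // cF.
have Hpm := pm_sub FW HF; have HW := pm_cover_sub FW HF.
set h := #|H|; set U := cover H.
have cU : #|U| = (2 * h)%N := pm_card Hpm.
have VE r : 'C(l - h + r, l - k + h)%:R =
    \sum_(s < (l - k + h).+1) ('C(r, s) * 'C(l - h, l - k + h - s))%:R :> R.
  by rewrite addnC -binomial.Vandermonde natr_sum.
under eq_bigr do rewrite VE mulr_sumr.
rewrite exchange_big /=.
have f0' G : (#|G| < #|F :\: H| + h)%N -> hat f A G = 0.
  by rewrite cFH subnK //; exact: f0.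
have inner (s : 'I_(l - k + h).+1) :
  \sum_(M in pm A | F :\: H \subset M)
     f M * ('C(#|within M U|, s) * 'C(l - h, l - k + h - s))%:R
  = 'C(l - h, l - k + h - s)%:R *
    (if val s == h then \sum_(Q in pm U) hat f A ((F :\: H) :|: Q) else 0).
  rewrite -(@sum_bin_within A f (F :\: H) U h s cU f0') mulr_sumr.
  by apply: eq_bigr => M _; rewrite natrM mulrA mulrC.
under eq_bigr do rewrite inner.
have hs : (h < (l - k + h).+1)%N by rewrite ltnS leq_addl.
rewrite (bigD1 (Ordinal hs)) //= eqxx [X in _ + X]big1 ?addr0; last first.
  move=> s shs; case: eqP => [sh|_]; last by rewrite mulr0.
  by case/eqP: shs; exact: val_inj.
(* The surviving coefficient ['C(l - h, l - k)] equals ['C(l - h, k - h)] by symmetry. *)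
rewrite addnK; congr (_ * _).
  rewrite -[in RHS]bin_sub; last by rewrite leq_sub2r.
  by congr ('C(_, _)%:R); move: Hk kl; rewrite -/h; clear; lia.
have FHpm : F :\: H \in pm (W :\: U) := pmD FW Hpm HF.
rewrite [RHS]/hat (@big_pm_ext _ _ _ +%R _ _ _ _ FHpm) ?subsetDl //.
by rewrite setD_sub_self.
Qed.

(* Pairs of matchings M, M' are expanded over their common sets G of n - k edges,
   sorted by H = F :\: G. The edges of M' avoiding the points of H number
   n - 2 #|H| + #|within M' (cover H)|, so Vandermonde's identity turns the count
   of the sets G into a sum over levels, all but the top one of which vanish. *)
Theorem hat_kact A n k j l f W F :
  #|A| = (2 * n)%N -> n = (j + l)%N -> (k <= l)%N ->
  (forall G, (#|G| < j)%N -> hat f A G = 0) ->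
  W \subset A -> F \in pm W -> #|F| = j ->
  hat (kact (pm A) (overlap R (n - k)) f) A F =
  \sum_(H : {set {set T}} | (H \subset F) && (#|H| <= k)%N)
     (odd_fact (k - #|H|) * 'C(l - #|H|, k - #|H|))%:R
       * hat (hat f A) W (F :\: H).
Proof.
move=> cA nE kl f0 WA FW cF.
have FA : cover F \subset A by rewrite (pm_cover FW).
have Fpm := pm_sub FW (subxx F).
rewrite {1}/hat /kact exchange_big /=.
transitivity (\sum_(M' in pm A) f M' *
  (\sum_(G : {set {set T}} | (G \subset M') && (#|G| == n - k)%N)
     #|[set M in pm A | (F \subset M) && (G \subset M)]|)%:R).
  apply: eq_bigr => M' M'A; rewrite -mulr_suml mulrC; congr (_ * _).
  rewrite -natr_sum; congr _%:R.
  under eq_bigr do rewrite -cards_draws -sum1dep_card.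
  rewrite (exchange_big_dep (fun G : {set {set T}} => (G \subset M') && (#|G| == n - k)%N)) /=.
    apply: eq_bigr => G /andP[GM' cG]; rewrite -sum1dep_card; apply: eq_bigl => M.
    by rewrite subsetI GM' cG !andbT andbA.
  by move=> M G _ /andP[]; rewrite subsetI => /andP[_ ->].
under [LHS]eq_bigr => M' M'A.
  rewrite (sum_card_common_ext cA nE kl FA Fpm cF M'A) natr_sum mulr_sumr; over.
rewrite exchange_big /=; apply: eq_bigr => H /andP[HF Hk].
rewrite natrM -mulrA -(sum_vandermonde kl f0 FW cF HF Hk) mulr_sumr big_mkcondr /=.
apply: eq_bigr => M' M'A; case: (F :\: H \subset M').
  by rewrite mul1n natrM mulrCA.
by rewrite mul0n muln0 mulr0.
Qed.

(* Summing over the matchings of the complement of W shows that u is as smooth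
   on W as the number of pairs left outside W allows. *)
Lemma hat_hat_eq0 A j l f W G :
  #|A| = (2 * (j + l))%N -> (forall H, (#|H| < j)%N -> hat f A H = 0) ->
  W \subset A -> #|W| = (2 * j)%N -> (#|G| + l < j)%N -> hat (hat f A) W G = 0.
Proof.
move=> cA f0 WA cW Gl.
have [F0 /andP[F0W GF0]|none] := pickP (fun F => (F \in pm W) && (G \subset F)); last first.
  by rewrite /hat big_pred0.
have dWA : [disjoint W & A :\: W] by rewrite disjoints_subset setCD subsetUr.
have AWA : A :\: W \subset A by exact: subsetDl.
rewrite [LHS]/hat; under eq_bigr => F /andP[FW _].
  rewrite /hat (@big_pm_ext _ _ _ +%R _ _ _ _ FW WA); over.
rewrite exchange_big /=; apply: big1 => Q QAW.
have cQ : #|Q| = l.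
  have := pm_card QAW; rewrite cardsDS // cA cW; clear; lia.
transitivity (hat f A (Q :|: G)); last first.
  by apply: f0; rewrite (leq_ltn_trans (leq_card_setU _ _)) // cQ addnC.
rewrite /hat; under [RHS]eq_bigl do rewrite subUset andbA.
rewrite [RHS]big_mkcondr /= (@big_pm_ext _ _ _ +%R _ _ _ _ QAW) //.
rewrite setD_sub_self // [LHS]big_mkcondr /=; apply: eq_bigr => F FW.
rewrite setUC; congr (if _ then _ else _); apply/idP/idP => [GF|].
  exact: subset_trans GF (subsetUr _ _).
move=> /subsetP GQF; apply/subsetP => e eG; case/setUP: (GQF _ eG) => // eQ.
have [x xe] := pm_edge_ex F0W (subsetP GF0 _ eG).
have xW := subsetP (pm_edge_sub F0W (subsetP GF0 _ eG)) _ xe.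
by have := subsetP (pm_edge_sub QAW eQ) _ xe; rewrite inE xW.
Qed.

End Intertwining.

(** * Eigenvalue bounds by level *)

Lemma sqr_sum_le (R : realFieldType) (I : finType) (P : pred I) (x : I -> R) :
  (\sum_(i | P i) x i) ^+ 2 <= #|[set i | P i]|%:R * \sum_(i | P i) x i ^+ 2.
Proof.
have -> : #|[set i | P i]|%:R * (\sum_(i | P i) x i ^+ 2) =
    \sum_(i | P i) \sum_(j | P j) (x i ^+ 2 + x j ^+ 2) / 2.
  under [RHS]eq_bigr do rewrite -mulr_suml big_split /= sumr_const.
  rewrite cardsE -mulr_suml big_split /= sumr_const sumrMnl.
  by rewrite -[_ *+ #|P|]mulr_natr; field.
rewrite expr2 mulr_suml; apply: ler_sum => i _; rewrite mulr_sumr.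
apply: ler_sum => j _; rewrite ler_pdivlMr //.
by have := sqr_ge0 (x i - x j); nra.
Qed.

(** The rising factorial with step [s]. It is of binomial type in [a], so it reproduces itself in
    the recursion over levels. *)
Definition rising (s a k : nat) : nat := (\prod_(r < k) (a + s * r))%N.

Lemma rising0 s a : rising s a 0 = 1%N.
Proof. by rewrite /rising big_ord0. Qed.

Lemma risingS s a k : rising s a k.+1 = (rising s a k * (a + s * k))%N.
Proof. by rewrite /rising big_ord_recr. Qed.

(** Induction on [k], splitting the last factor [a + b + s * k] as
    [(a + s * i) + (b + s * (k - i))]. *)
Lemma rising_vandermonde s a b k :
  (\sum_(i < k.+1) 'C(k, i) * (rising s a i * rising s b (k - i)))%N
    = rising s (a + b) k.
Proof.
elim: k => [|k IH]; first by rewrite big_ord1 /= !rising0.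
rewrite risingS -IH big_distrl /=.
transitivity (\sum_(i < k.+1) 'C(k, i) * (rising s a i.+1 * rising s b (k - i))
  + \sum_(i < k.+1) 'C(k, i) * (rising s a i * rising s b (k - i).+1))%N; last first.
  rewrite -big_split /=; apply: eq_bigr => i _; rewrite !risingS.
  have -> : (s * k = s * i + s * (k - i))%N by rewrite -mulnDr subnKC // -ltnS.
  by ring.
rewrite [LHS]big_ord_recl /= bin0 mul1n subn0 rising0 mul1n.
under [X in (_ + X)%N = _] eq_bigr do rewrite binS mulnDl /bump add1n subSS.
rewrite big_split /= addnA addnC; congr (_ + _)%N.
rewrite [in LHS]big_ord_recr /= bin_small ?mul0n ?addn0 //.
rewrite [RHS]big_ord_recl /= bin0 mul1n subn0 rising0 mul1n.
congr (_ + _)%N; apply: eq_bigr => i _.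
by rewrite /bump add1n subnSK.
Qed.

Lemma rising_mono s s' a k : (s <= s')%N -> (rising s a k <= rising s' a k)%N.
Proof.
by move=> ss'; apply: leq_prod => i _; rewrite leq_add2l leq_mul2r ss' orbT.
Qed.

(** Since l (2r + 1) = l + 2l r, the double factorials of the walk are rising factorials of step
    [2 * l]; this fixes the step used from here on. *)
Lemma odd_fact_rising l s : (odd_fact s * l ^ s)%N = rising (2 * l) l s.
Proof.
elim: s => [|s IH]; first by rewrite /rising big_ord0.
by rewrite risingS -IH expnS /= -mul2n; ring.
Qed.

Lemma ffact_le_exp n m k : (n <= m)%N -> (n ^_ k <= m ^ k)%N.
Proof.
elim: k n => [|k IH] n nm; first by rewrite ffactn0.
by rewrite ffactnS expnS leq_mul // IH // (leq_trans (leq_pred n)).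
Qed.

Lemma fact_odd_bin_le l i s :
  (s`! * (odd_fact s * 'C(l - i, s)) <= rising (2 * l) l s)%N.
Proof.
rewrite -odd_fact_rising mulnCA leq_mul2l mulnC bin_ffact.
by rewrite ffact_le_exp ?leq_subr ?orbT.
Qed.

Section EigenvalueBounds.
Context (T : finType) (R : rcfType).
Implicit Types (A B C U W e : {set T}) (M N F G H Q : {set {set T}}).
Implicit Types (f u : {set {set T}} -> R).
Local Notation pm := perfect_matchings.
Local Notation act A d := (kact (pm A) (overlap R d)).

Lemma qform_ge0 A d f : 0 <= qform A d f.
Proof. by apply: sumr_ge0 => G _; exact: sqr_ge0. Qed.

(** Cauchy-Schwarz over the matchings containing each [G]. The constant is the row sum of
    [overlap d], so this is the trivial bound of the normalised walk by 1. *)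
Lemma qform_le A n d f : #|A| = (2 * n)%N ->
  qform A d f <= ('C(n, d) * odd_fact (n - d))%:R * \sum_(M in pm A) f M ^+ 2.
Proof.
move=> cA.
apply: (@le_trans _ _ (\sum_(G : {set {set T}} | #|G| == d)
    (odd_fact (n - d))%:R * \sum_(M in pm A | G \subset M) f M ^+ 2)).
  apply: ler_sum => G /eqP cG.
  have [M0 /andP[M0A GM0]|none] := pickP (fun M => (M \in pm A) && (G \subset M)).
    by rewrite -cG -(card_pm_ext M0A GM0 cA); exact: sqr_sum_le.
  by rewrite /hat !big_pred0 // expr2 !mulr0.
rewrite -mulr_sumr (exchange_big_dep (mem (pm A))) /=; last by move=> G M _ /andP[].
rewrite mulnC natrM -mulrA ler_wpM2l // mulr_sumr le_eqVlt; apply/orP; left.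
apply/eqP/eq_bigr => M MA; have -> : n = #|M| by have := pm_card MA; rewrite cA; lia.
rewrite -cards_draws mulrC mulr_natr -sumr_const; apply: eq_bigl => G.
by rewrite inE MA andbC.
Qed.

(** The sets [F :\: H] with [#|H| = i] are all subsets of [F] of [j - i] pairs, so the terms of
    [hat_kact] with [#|H| = i] assemble into an overlap kernel on [W]. *)
Lemma hat_kact_levels A n k j l f W F :
  #|A| = (2 * n)%N -> n = (j + l)%N -> (k <= l)%N ->
  (forall G, (#|G| < j)%N -> hat f A G = 0) ->
  W \subset A -> F \in pm W -> #|F| = j ->
  hat (act A (n - k) f) A F =
  \sum_(i < k.+1 | (i <= j)%N) (odd_fact (k - i) * 'C(l - i, k - i))%:R
       * act W (j - i) (hat f A) F.
Proof.
move=> cA nE kl f0 WA FW cF; rewrite (hat_kact cA nE kl f0 WA FW cF).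
rewrite (partition_big (fun H : {set {set T}} => inord #|H| : 'I_k.+1)
   (fun i : 'I_k.+1 => (i <= j)%N)) /=; last first.
  move=> H /andP[HF Hk]; rewrite inordK ?ltnS //.
  by rewrite -cF subset_leq_card.
apply: eq_bigr => i ij; rewrite kact_overlap mulr_sumr.
rewrite (reindex_onto (fun G => F :\: G) (fun H => F :\: H)) /=; last first.
  by move=> H /andP[/andP[HF _] _]; rewrite setD_sub_self.
apply: eq_big => G.
  rewrite subsetDl /=; apply/andP/andP.
    case=> /andP[Hk /eqP Hi] /eqP FG; have GF : G \subset F by rewrite -FG subsetDl.
    split=> //; rewrite -FG cardsDS ?subsetDl // cF -Hi inordK ?ltnS //.
  case=> GF /eqP cG; have cFG : #|F :\: G| = i.
    by rewrite cardsDS // cF cG subKn.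
  rewrite cFG -ltnS ltn_ord setD_sub_self // eqxx; split=> //=.
  by apply/eqP/val_inj; rewrite /= inordK.
case/andP=> /andP[/andP[_ Hk] /eqP Hi] /eqP FG.
by rewrite FG -Hi inordK ?ltnS.
Qed.

(** The stability demanded by [rayleigh_bound]. Either [G] leaves room for [k] pairs and
    [hat_kact_levels] expresses the value through [hat f A] at level [#|G|], or every set of [n - k]
    pairs is smaller than [G]. *)
Lemma hat_kshift_eq0 A n k J f lam : #|A| = (2 * n)%N -> (k <= n)%N ->
  (forall G, (#|G| < J)%N -> hat f A G = 0) ->
  forall G, (#|G| < J)%N -> hat (kshift (pm A) (overlap R (n - k)) lam f) A G = 0.
Proof.
move=> cA kn f0 G GJ.
have -> : hat (kshift (pm A) (overlap R (n - k)) lam f) A G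
    = hat (act A (n - k) f) A G - lam * hat f A G.
  by rewrite /hat mulr_sumr -sumrB.
rewrite f0 // mulr0 subr0.
have [M0 /andP[M0A GM0]|none] := pickP (fun M => (M \in pm A) && (G \subset M)); last first.
  by rewrite /hat big_pred0.
have [kG|Gk] := leqP k (n - #|G|); last first.
  apply: big1 => M _; rewrite kact_overlap big1 // => H /andP[_ /eqP cH].
  by apply: f0; rewrite cH; apply: leq_ltn_trans GJ; move: Gk kn; clear; lia.
have Gn : (#|G| <= n)%N.
  rewrite (leq_trans (subset_leq_card GM0)) //.
  by have := pm_card M0A; rewrite cA; clear; lia.
have nE : n = (#|G| + (n - #|G|))%N by rewrite subnKC.
rewrite (hat_kact_levels cA nE kG _ (pm_cover_sub M0A GM0) (pm_sub M0A GM0) erefl).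
  apply: big1 => i _; rewrite kact_overlap [X in _ * X]big1 ?mulr0 // => H _.
  apply: big1 => F /andP[FG _]; apply: f0.
  suff -> : #|F| = #|G| by [].
  have := pm_card FG; rewrite (pm_card (pm_sub M0A GM0)); clear; lia.
by move=> H HG; apply: f0; exact: ltn_trans GJ.
Qed.

(* At the lowest level j where f is visible, [hat_kact] closes up into an equation
   for u = hat f A between walks re-matching i <= k pairs among 2j points. *)
Lemma eigenvector_level A n k f mu : #|A| = (2 * n)%N -> (k <= n)%N ->
  (exists2 M, M \in pm A & f M != 0) ->
  {in pm A, forall M, act A (n - k) f M = mu * f M} -> 0 < mu ->
  exists j l W u,
  [/\ n = (j + l)%N, (k <= l)%N, #|W| = (2 * j)%N & 0 < \sum_(F in pm W) u F ^+ 2] /\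
  [/\ forall G, (#|G| < j)%N -> hat f A G = 0,
      forall J, (forall G, (#|G| < J)%N -> hat f A G = 0) -> (J <= j)%N,
      forall G, (#|G| + l < j)%N -> hat u W G = 0
    & mu * \sum_(F in pm W) u F ^+ 2 =
      \sum_(i < k.+1 | (i <= j)%N) (odd_fact (k - i) * 'C(l - i, k - i))%:R
         * qform W (j - i) u].
Proof.
move=> cA kn [M0 M0A fM0] eig mu0.
have ex : exists j, [exists G : {set {set T}}, (#|G| == j) && (hat f A G != 0)].
  by exists #|M0|; apply/existsP; exists M0; rewrite eqxx hat_full.
case: (ex_minnP ex) => j /existsP[F /andP[/eqP cF hF]] jmin.
have f0 G : (#|G| < j)%N -> hat f A G = 0.
  move=> Gj; apply/eqP/negPn/negP => hG; move: Gj; rewrite ltnNge => /negP; apply.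
  by apply: jmin; apply/existsP; exists G; rewrite eqxx.
have [M /andP[MA FM]|none] := pickP (fun M => (M \in pm A) && (F \subset M)); last first.
  by move: hF; rewrite /hat big_pred0 ?eqxx.
have jn : (j <= n)%N.
  rewrite -cF (leq_trans (subset_leq_card FM)) //.
  by have := pm_card MA; rewrite cA; clear; lia.
have nE : n = (j + (n - j))%N by rewrite subnKC.
(* Otherwise [n - k < j], so every term of [kact_overlap] vanishes and the eigenvalue would be 0,
   against [0 < mu]. *)
have kl : (k <= n - j)%N.
  rewrite leqNgt; apply/negP => lk; case/negP: fM0.
  have /eqP := eig _ M0A; rewrite kact_overlap big1.
    by rewrite eq_sym mulf_eq0 gt_eqF.
  by move=> G /andP[_ /eqP cG]; apply: f0; rewrite cG; move: lk kn; clear; lia.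
have FW := pm_sub MA FM; have WA := pm_cover_sub MA FM.
exists j, (n - j)%N, (cover F), (hat f A); split; split=> //.
- by rewrite (pm_card FW) cF.
- rewrite (bigD1 F) //= ltr_pwDl //; first by rewrite lt_def sqr_ge0 sqrf_eq0 hF.
  by apply: sumr_ge0 => *; exact: sqr_ge0.
- move=> J hJ; rewrite leqNgt; apply/negP => jJ.
  by move: hF; rewrite hJ ?eqxx // cF.
- move=> G Gl; apply: (hat_hat_eq0 (j := j) (l := n - j)) => //; first by rewrite -nE.
  by rewrite (pm_card FW) cF.
rewrite mulr_sumr.
under eq_bigr => F' F'W.
  have cF' : #|F'| = j.
    by have := pm_card F'W; rewrite (pm_card FW) cF; clear; lia.
  rewrite expr2 mulrCA.
  have -> : mu * hat f A F' = hat (act A (n - k) f) A F'.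
    by rewrite /hat mulr_sumr; apply: eq_bigr => N /andP[/eig -> _].
  rewrite (hat_kact_levels cA nE kl f0 WA F'W cF') mulr_sumr.
  over.
rewrite exchange_big /=; apply: eq_bigr => i _.
rewrite -qformE mulr_sumr; apply: eq_bigr => F' _.
by rewrite mulrCA.
Qed.

End EigenvalueBounds.

Section SpectralBounds.
Context (T : finType) (R : rcfType).
Implicit Types (A B C U W e : {set T}) (M N F G H Q : {set {set T}}).
Implicit Types (f u : {set {set T}} -> R).
Local Notation pm := perfect_matchings.
Local Notation act A d := (kact (pm A) (overlap R d)).

Lemma rayleigh_hat A n k J theta : #|A| = (2 * n)%N -> (k <= n)%N ->
  (forall f mu, (forall G, (#|G| < J)%N -> hat f A G = 0) ->
     (exists2 M, M \in pm A & f M != 0) ->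
     {in pm A, forall M, act A (n - k) f M = mu * f M} -> mu <= theta) ->
  forall f, (forall G, (#|G| < J)%N -> hat f A G = 0) ->
    qform A (n - k) f <= theta * \sum_(M in pm A) f M ^+ 2.
Proof.
move=> cA kn eig f f0; rewrite -qformE.
have sym : forall M N : {set {set T}}, overlap R (n - k) M N = overlap R (n - k) N M.
  by move=> M N; exact: overlap_sym.
have [e [d ed]] := eigenbasis_exists (pm A) sym.
apply: (rayleigh_bound sym ed (V := fun f => forall G, (#|G| < J)%N -> hat f A G = 0)) => //.
by move=> lam g; exact: hat_kshift_eq0.
Qed.

(** Strong induction on [n]. An eigenvector has a level [j] with [l <= m], and its [u], on 2j
    points, satisfies the hypothesis with [l] in place of [m]. The factorial of [k] turns the
    coefficients into binomial ones, and [rising_vandermonde] with [n = l + j] adds up the inductive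
    bounds. *)
Lemma qform_rising n A m k f : #|A| = (2 * n)%N -> (k <= n)%N ->
  (forall G, (#|G| + m < n)%N -> hat f A G = 0) ->
  k`!%:R * qform A (n - k) f
    <= (rising (2 * m) n k)%:R * \sum_(M in pm A) f M ^+ 2.
Proof.
elim/ltn_ind: n A m k f => n IH A m k f cA kn f0.
(* The case [k = 0] is separate: the descent to [j < n] needs [l > 0], which comes from
   [0 < k <= l]. *)
have [->|k0] := posnP k.
  rewrite fact0 mul1r subn0 /rising big_ord0 mul1r.
  by have := qform_le n f cA; rewrite subnn binn muln1 mul1r.
have kf : 0 < k`!%:R :> R by rewrite ltr0n fact_gt0.
rewrite -ler_pdivlMl // mulrA; move: f f0.
have VJ f : (forall G, (#|G| + m < n)%N -> hat f A G = 0) <->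
    (forall G, (#|G| < n - m)%N -> hat f A G = 0).
  by split=> h G Gn; apply: h; rewrite ?ltn_subRL addnC // -ltn_subRL.
suff main f : (forall G, (#|G| < n - m)%N -> hat f A G = 0) ->
    qform A (n - k) f <= k`!%:R^-1 * (rising (2 * m) n k)%:R * \sum_(M in pm A) f M ^+ 2.
  by move=> f /VJ; exact: main.
apply: rayleigh_hat => // {}f mu f0 fN eig.
have [mu0|mu0] := leP mu 0.
  by apply: le_trans mu0 _; rewrite mulr_ge0 ?invr_ge0.
have [j [l [W [u [[nE kl cW S0] [_ Jj u0 eq]]]]]] := eigenvector_level cA kn fN eig mu0.
have lm : (l <= m)%N by have := Jj _ f0; rewrite nE; clear; lia.
rewrite ler_pdivlMl // -(ler_pM2r S0) -mulrA eq mulr_sumr.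
apply: (@le_trans _ _ ((rising (2 * l) n k)%:R * \sum_(F in pm W) u F ^+ 2)); last first.
  by rewrite ler_wpM2r ?(ltW S0) // ler_nat rising_mono // leq_mul2l lm orbT.
rewrite [in leRHS]nE addnC -rising_vandermonde natr_sum mulr_suml big_mkcond /=.
have jn : (j < n)%N by rewrite nE -[X in (X < _)%N]addn0 ltn_add2l (leq_trans k0).
rewrite [leRHS](reindex_inj rev_ord_inj) /=.
apply: ler_sum => i _; have ik : (i <= k)%N by rewrite -ltnS.
rewrite subSS; case: ifP => ij; last by rewrite mulr_ge0 ?ler0n ?(ltW S0).
have IHi := IH j jn W l i u cW ij u0.
rewrite subKn // bin_sub //.
have -> : ('C(k, i) * (rising (2 * l) l (k - i) * rising (2 * l) j i))%:R
    * \sum_(F in pm W) u F ^+ 2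
  = ('C(k, i) * rising (2 * l) l (k - i))%:R
    * ((rising (2 * l) j i)%:R * \sum_(F in pm W) u F ^+ 2) :> R.
  by rewrite !natrM; ring.
have -> : k`! = ('C(k, i) * ((k - i)`! * i`!))%N.
  by rewrite -(bin_fact ik) [((k - i)`! * _)%N]mulnC.
have -> : ('C(k, i) * ((k - i)`! * i`!))%:R *
    ((odd_fact (k - i) * 'C(l - i, k - i))%:R * qform W (j - i) u)
  = ('C(k, i) * ((k - i)`! * (odd_fact (k - i) * 'C(l - i, k - i))))%:R
     * (i`!%:R * qform W (j - i) u).
  by rewrite !natrM; ring.
apply: ler_pM => //; first by rewrite mulr_ge0 ?qform_ge0 ?ler0n.
by rewrite ler_nat leq_mul2l; have := fact_odd_bin_le l i (k - i) => ->; rewrite orbT.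
Qed.

(** Divided by ['C(n, k) * odd_fact k] with [n = j + l], this is at most the probability that the
    broken pairs lying in a given set of [j] pairs are re-matched among themselves; [i] is their
    number. *)
Definition level_bound (k j l : nat) : nat :=
  (\sum_(i < k.+1 | (i <= j)%N)
    (odd_fact (k - i) * 'C(l - i, k - i)) * ('C(j, i) * odd_fact i))%N.

(** Both bounds hold for the same level [j], so each level may later use whichever is better. *)
Lemma eigenvalue_le A n k J f mu : #|A| = (2 * n)%N -> (k <= n)%N ->
  (forall G, (#|G| < J)%N -> hat f A G = 0) ->
  (exists2 M, M \in pm A & f M != 0) ->
  {in pm A, forall M, act A (n - k) f M = mu * f M} -> 0 < mu ->
  exists j l, [/\ n = (j + l)%N, (k <= l)%N, (J <= j)%N,
    mu <= (level_bound k j l)%:R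
    & k`!%:R * mu <= (rising (2 * l) n k)%:R].
Proof.
move=> cA kn f0 fN eig mu0.
have [j [l [W [u [[nE kl cW S0] [fj0 Jj u0 eq]]]]]] := eigenvector_level cA kn fN eig mu0.
exists j, l; split=> //; first exact: Jj.
  rewrite -(ler_pM2r S0) eq natr_sum mulr_suml.
  apply: ler_sum => i ij; rewrite [X in _ <= X * _]natrM -[leRHS]mulrA ler_wpM2l //.
  by have := qform_le (j - i) u cW; rewrite bin_sub // subKn.
have f0l G : (#|G| + l < n)%N -> hat f A G = 0.
  have [Gj|jG] := ltnP #|G| j; last by rewrite nE ltnNge leq_add2r jG.
  by move=> _; exact: fj0.
have S0' : 0 < \sum_(M in pm A) f M ^+ 2.
  case: fN => M MA fM; rewrite (bigD1 M) //= ltr_pwDl //.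
    by rewrite lt_def sqr_ge0 sqrf_eq0 fM.
  by apply: sumr_ge0 => *; exact: sqr_ge0.
rewrite -(ler_pM2r S0') -mulrA.
have -> : mu * \sum_(M in pm A) f M ^+ 2 = qform A (n - k) f.
  rewrite -qformE mulr_sumr; apply: eq_bigr => M MA.
  by rewrite eig // expr2 mulrCA.
exact: qform_rising.
Qed.
End SpectralBounds.

(** * Powers of the kernel *)

Section KernelPowers.
Context (R : rcfType) (Y : finType) (D : {set Y}) (kap : Y -> Y -> R).

Fixpoint kpow (t : nat) (x y : Y) : R :=
  if t is t'.+1 then \sum_(z in D) kap x z * kpow t' z y else (x == y)%:R.

Lemma kpow_ge0 t x y : (forall x y, 0 <= kap x y) -> 0 <= kpow t x y.
Proof.
move=> kap0; elim: t x => [|t IH] x /=; first exact: ler0n.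
by apply: sumr_ge0 => z _; rewrite mulr_ge0.
Qed.

Lemma kpow_invariant (phi : Y -> Y) :
  injective phi -> {in D, forall x, phi x \in D} ->
  (forall x y, kap (phi x) (phi y) = kap x y) ->
  forall t x y, kpow t (phi x) (phi y) = kpow t x y.
Proof.
move=> inj phiD inv; elim=> [|t IH] x y /=; first by rewrite (inj_eq inj).
have phiDE z : (phi z \in D) = (z \in D).
  have /subset_leqif_cards : phi @: D \subset D.
    by apply/subsetP => _ /imsetP[z' z'D ->]; exact: phiD.
  rewrite card_imset // => -[_]; rewrite eqxx => /esym/eqP DE.
  by rewrite -[in LHS]DE mem_imset.
rewrite (reindex_inj inj) /=; apply: eq_big => z; first exact: phiDE.
by move=> _; rewrite inv IH.
Qed.

Variables (e : 'I_#|D| -> Y -> R) (d : 'I_#|D| -> R).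
Hypotheses (kap_sym : forall x y, kap x y = kap y x) (ed : eigenbasis kap e d).

Lemma kpow_spectral t :
  {in D &, forall x y, kpow t x y = \sum_m d m ^+ t * (e m x * e m y)}.
Proof.
have [on _ eig] := ed.
elim: t => [|t IH] x y xD yD /=.
  by rewrite -on //; apply: eq_bigr => m _; rewrite mul1r.
under eq_bigr => z zD do rewrite IH // mulr_sumr.
rewrite exchange_big /=; apply: eq_bigr => m _.
transitivity (kact D kap (e m) x * (d m ^+ t * e m y)).
  by rewrite mulr_suml; apply: eq_bigr => z _; ring.
by rewrite eig // exprS; ring.
Qed.

Lemma kpow_trace t : \sum_(x in D) kpow t x x = \sum_m d m ^+ t.
Proof.
have [_ orth _] := ed.
under eq_bigr => x xD do rewrite kpow_spectral //.
rewrite exchange_big /=; apply: eq_bigr => m _.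
by rewrite -mulr_sumr orth eqxx mulr1.
Qed.

Lemma kpow_sqr t : {in D, forall x, \sum_(y in D) kpow t x y ^+ 2 = kpow (t + t) x x}.
Proof.
have [_ orth _] := ed.
move=> x xD; rewrite kpow_spectral //.
transitivity (\sum_(y in D) \sum_m \sum_m'
   (d m ^+ t * e m x * (d m' ^+ t * e m' x)) * (e m y * e m' y)).
  apply: eq_bigr => y yD; rewrite kpow_spectral // expr2 mulr_suml.
  apply: eq_bigr => m _; rewrite mulr_sumr; apply: eq_bigr => m' _.
  by ring.
rewrite exchange_big /=; apply: eq_bigr => m _; rewrite exchange_big /=.
rewrite (bigD1 m) //= [X in _ + X]big1 ?addr0 => [|m' mm']; rewrite -mulr_sumr orth.
  by rewrite eqxx exprD /= mulr1n; ring.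
by rewrite eq_sym (negbTE mm') mulr0.
Qed.

End KernelPowers.

(* Charging each d m to the first threshold it exceeds. *)
Lemma sum_exp_le_thresholds (R : realFieldType) (I : finType) (d : I -> R)
    (theta : nat -> R) (C : nat -> nat) (n s : nat) :
  theta 0 = 1 -> (forall j, 0 <= theta j) -> (forall m, 0 <= d m <= 1) ->
  (forall j, (j < n)%N -> (#|[set m | (theta j.+1 < d m)%R]| <= C j)%N) ->
  (#|I| <= C n)%N ->
  \sum_m d m ^+ s <= \sum_(j < n.+1) (C j)%:R * theta j ^+ s.
Proof.
move=> th0 thp d01 hC hn.
have key p m : d m ^+ s <=
    \sum_(j < p) (theta j.+1 < d m)%R%:R * theta j ^+ s + theta p ^+ s.
  elim: p => [|p IH].
    rewrite big_ord0 add0r th0 lerXn2r ?nnegrE ?ler01 //.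
      by case/andP: (d01 m).
    by case/andP: (d01 m).
  have [dm|dm] := leP (d m) (theta p.+1).
    rewrite (le_trans (lerXn2r s _ _ dm)) ?nnegrE ?thp //.
      by case/andP: (d01 m).
    by rewrite lerDr sumr_ge0 // => j _; rewrite mulr_ge0 ?exprn_ge0.
  rewrite (le_trans IH) // big_ord_recr /= dm mul1r lerDl exprn_ge0 //.
apply: (le_trans (ler_sum _ (fun m _ => key n m))).
rewrite big_split /= sumr_const big_ord_recr /= exchange_big /=.
apply: lerD.
  apply: ler_sum => j _; rewrite -mulr_suml ler_wpM2r ?exprn_ge0 //.
  rewrite -natr_sum ler_nat (leq_trans _ (hC j (ltn_ord j))) //.
  by rewrite -sum1dep_card [leqRHS]big_mkcond; apply: leq_sum => m _; case: ifP.
by rewrite -[_ *+ #|I|]mulr_natl ler_wpM2r ?exprn_ge0 // ler_nat.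
Qed.

(** * The trace of the overlap kernel *)

Section MatchingSpectrum.
Context (T : finType) (R : rcfType).
Implicit Types (A B C U W e : {set T}) (M N F G H Q : {set {set T}}).
Implicit Types (f u : {set {set T}} -> R).
Local Notation pm := perfect_matchings.

(** The test functions for the threshold [theta j.+1] are the indicators of [G \subset M] with
    [#|G| = j]: a function orthogonal to all of them has [hat] zero at level [j], hence below, so
    only levels from [j + 1] on occur. The index shift makes the count for [j] multiply
    [theta j]. *)
Lemma overlap_spectrum A n k (theta : nat -> R) s :
  #|A| = (2 * n)%N -> (0 < k <= n)%N ->
  theta 0 = 1 -> (forall j, 0 <= theta j) ->
  (forall j j' l, (0 < j <= j')%N -> n = (j' + l)%N -> (k <= l)%N ->
     (level_bound k j' l)%:R <= theta j * ('C(n, k) * odd_fact k)%:R \/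
     (rising (2 * l) n k)%:R <= theta j * (k`! * ('C(n, k) * odd_fact k))%:R) ->
  \sum_(M in pm A) kpow (pm A) (overlap R (n - k)) s M M
    / ('C(n, k) * odd_fact k)%:R ^+ s
  <= \sum_(j < n.+1) ('C('C(n.*2, 2), j))%:R * theta j ^+ s.
Proof.
move=> cA /andP[k0 kn] th0 thp hth; set c : R := (_ * odd_fact k)%:R.
have c0 : 0 < c by rewrite ltr0n muln_gt0 bin_gt0 kn odd_fact_gt0.
have sym : forall M N, overlap R (n - k) M N = overlap R (n - k) N M.
  by move=> M N; exact: overlap_sym.
have [e [d ed]] := eigenbasis_exists (pm A) sym.
rewrite -mulr_suml (kpow_trace ed) mulr_suml.
under eq_bigr do rewrite -exprVn -exprMn.
have [_ orth eig] := ed.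
have dE m : d m = qform A (n - k) (e m).
  rewrite -qformE; under eq_bigr => M MA do rewrite eig // mulrCA.
  by rewrite -mulr_sumr orth eqxx mulr1.
have e1 m : \sum_(M in pm A) e m M ^+ 2 = 1.
  by under eq_bigr do rewrite expr2; rewrite orth eqxx.
have pairs j : #|[set G : {set {set T}} |
    (G \subset [set e : {set T} | (e \subset A) && (#|e| == 2%N)]) && (#|G| == j)]|
    = 'C('C(n.*2, 2), j).
  by rewrite cards_draws cards_draws cA mul2n.
apply: sum_exp_le_thresholds => //.
- move=> m; rewrite divr_ge0 ?(ltW c0) //=; last by rewrite dE qform_ge0.
  rewrite ler_pdivrMr // mul1r dE.
  by have := qform_le (n - k) (e m) cA; rewrite e1 mulr1 bin_sub // subKn.
- move=> j jn; rewrite -pairs.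
  under eq_finset do rewrite ltr_pdivlMr //.
  apply: (card_large_eigenvalues sym ed (phi := fun G M => (G \subset M)%:R)) => f f0.
  rewrite qformE; apply: (rayleigh_hat (J := j.+1) cA kn).
    move=> g mu g0 gN geig; have [mu0|mu0] := leP mu 0.
      by rewrite (le_trans mu0) // mulr_ge0 // ltW.
    have [j' [l [nE kl jj' le1 le2]]] := eigenvalue_le cA kn g0 gN geig mu0.
    case: (hth j.+1 j' l _ nE kl) => [|h|h]; first by rewrite jj'.
      exact: le_trans h.
    have kf : 0 < k`!%:R :> R by rewrite ltr0n fact_gt0.
    by rewrite -(ler_pM2l kf) (le_trans le2) // (le_trans h) // natrM -/c; lra.
  move=> G Gj; apply: (hat_level (j := j) cA); first by rewrite -ltnS Gj ltnW.
  move=> G' cG'; have [G'A|G'A] := boolP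
      (G' \subset [set e : {set T} | (e \subset A) && (#|e| == 2%N)]).
    rewrite -(f0 G'); last by rewrite inE G'A cG' eqxx.
    rewrite /hat big_mkcondr; apply: eq_bigr => M _.
    by case: ifP; rewrite ?mulr1 ?mulr0.
  apply: hat0_out => M MA; apply: contra G'A => /subsetP G'M.
  apply/subsetP => x /G'M xM.
  by rewrite inE (pm_edge_sub MA xM) (pm_card2 MA xM).
(* The last count bounds the number of all eigenvalues: a matching is itself a set of [n] pairs. *)
rewrite card_ord -pairs; apply/subset_leq_card/subsetP => M MA; rewrite inE.
apply/andP; split.
  apply/subsetP => x xM.
  by rewrite inE (pm_edge_sub MA xM) (pm_card2 MA xM).
by have := pm_card MA; rewrite cA => /eqP; rewrite eqn_pmul2l // eq_sym.
Qed.
End MatchingSpectrum.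

(** * Symmetry under permutations of the points *)

Section Relabelling.
Context (T : finType) (R : rcfType).
Implicit Types (A e : {set T}) (M N : {set {set T}}) (s : {perm T}).
Local Notation pm := perfect_matchings.

Definition relabel s M : {set {set T}} := [set s @: (e : {set T}) | e in M].

Lemma relabel_inj s : injective (relabel s).
Proof. by apply: imset_inj; apply: imset_inj; exact: perm_inj. Qed.

Lemma relabel_overlap s d M N :
  overlap R d (relabel s M) (relabel s N) = overlap R d M N.
Proof.
rewrite /overlap /relabel -imsetI ?card_imset //; first by apply: imset_inj; exact: perm_inj.
by move=> x y _ _; apply: imset_inj; exact: perm_inj.
Qed.

Lemma relabel_pm s A M : s @: A = A -> M \in pm A -> relabel s M \in pm A.
Proof.
move=> sA MA; apply/pmP; split.
- apply/setP => x; apply/bigcupP/idP => [[_ /imsetP[e eM ->]]|].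
    by apply/subsetP; rewrite -sA imsetS // (pm_edge_sub MA eM).
  rewrite -sA => /imsetP[y yA ->]; have [e eM ye] := pm_edge MA yA.
  by exists (s @: e); rewrite imset_f.
- apply/trivIsetP => _ _ /imsetP[e eM ->] /imsetP[e' e'M ->] ee'.
  rewrite -setI_eq0 -imsetI; last by move=> x y _ _; exact: perm_inj.
  have [_ /trivIsetP/(_ _ _ eM e'M) dis _] := pmP _ _ MA.
  rewrite disjoint_setI0 ?imset0 ?eqxx // dis //.
  by apply: contra ee' => /eqP ->.
- move=> _ /imsetP[e eM ->]; rewrite card_imset ?(pm_card2 MA eM) //.
  exact: perm_inj.
Qed.

(** If [{a, b}] is in [N] but not in [M], and [{a, c}] is in [M], the transposition of [b] and [c]
    turns the latter pair into the former. It fixes the common pairs, none of which contains [b] or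
    [c]. *)
Lemma relabel_closer A M N : M \in pm A -> N \in pm A -> M != N ->
  exists s, s @: A = A /\ (#|M :&: N| < #|relabel s M :&: N|)%N.
Proof.
move=> MA NA MN.
have [e eN eM] : exists2 e, e \in N & e \notin M.
  apply/exists_inP; apply: contraR MN; rewrite negb_exists_in => /forall_inP NM.
  rewrite eq_sym; apply/eqP; apply: (pm_inj_sub NA MA).
  by apply/subsetP => e /NM /negPn.
have /cards2P [a [b [ab eE]]] : #|e| == 2%N by rewrite (pm_card2 NA eN).
have aA : a \in A by rewrite (subsetP (pm_edge_sub NA eN)) // eE !inE eqxx.
have bA : b \in A by rewrite (subsetP (pm_edge_sub NA eN)) // eE !inE eqxx orbT.
have [f fM af] := pm_edge MA aA.
have [c ca fE] : exists2 c, c != a & f = [set a; c].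
  have : #|f :\ a| = 1%N by have := cardsD1 a f; rewrite af (pm_card2 MA fM) => -[].
  move/eqP/cards1P => [c cE]; have : c \in f :\ a by rewrite cE inE.
  rewrite !inE => /andP[ca cf]; exists c => //.
  by rewrite -(setD1K af) cE.
have cb : c != b by apply: contraNneq eM => cb; rewrite eE -cb -fE.
have cA : c \in A by rewrite (subsetP (pm_edge_sub MA fM)) // fE !inE eqxx orbT.
exists (tperm b c); split.
  apply/eqP; rewrite eqEcard card_imset ?leqnn ?andbT; last exact: perm_inj.
  by apply/subsetP => _ /imsetP[x xA ->]; case: tpermP.
apply: proper_card; rewrite properE; apply/andP; split.
  apply/subsetP => g; rewrite !inE => /andP[gM gN]; rewrite gN andbT.
  have bg : b \notin g.
    apply: contra eM => bg; suff -> : e = g by [].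
    by apply: (pm_edge_uniq NA eN gN (x := b)) => //; rewrite eE !inE eqxx orbT.
  have cg : c \notin g.
    apply/negP => cg; have gf : g = f.
      by apply: (pm_edge_uniq MA gM fM (x := c)) => //; rewrite fE !inE eqxx orbT.
    case/negP: eM; suff -> : e = g by [].
    by apply: (pm_edge_uniq NA eN gN (x := a)) => //; rewrite ?gf // eE !inE eqxx.
  apply/imsetP; exists g => //; rewrite -[LHS]imset_id; apply: eq_in_imset => x xg.
  by rewrite tpermD //; [apply: contraNneq bg|apply: contraNneq cg] => ->.
apply/negP => /subsetP/(_ e); rewrite !inE eN (negbTE eM) => h.
suff : false by []; apply: h; rewrite andbT.
apply/imsetP; exists f => //; rewrite fE eE imsetU !imset_set1 tpermR.
by rewrite tpermD // eq_sym // eq_sym.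
Qed.

(** Hence each diagonal entry is the trace divided by the number of matchings, which makes a trace
    bound uniform in the starting point. *)
Lemma kpow_diag_const A d t M N : M \in pm A -> N \in pm A ->
  kpow (pm A) (overlap R d) t M M = kpow (pm A) (overlap R d) t N N.
Proof.
have [m] := ubnP (#|N| - #|M :&: N|)%N; elim: m M => // m IH M lm MA NA.
have [->//|MN] := eqVneq M N.
have [s [sA lt]] := relabel_closer MA NA MN.
have sMA := relabel_pm sA MA.
rewrite -(IH (relabel s M)) //.
  apply/esym/(kpow_invariant (relabel_inj (s := s))) => [K KA|K L].
    exact: relabel_pm.
  exact: relabel_overlap.
have : (#|relabel s M :&: N| <= #|N|)%N by rewrite subset_leq_card ?subsetIr.
move: lm lt; clear; lia.
Qed.

Lemma kpow_diag_le A n k (theta : nat -> R) (t : nat) M :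
  #|A| = (2 * n)%N -> (0 < k <= n)%N ->
  theta 0 = 1 -> (forall j, 0 <= theta j) ->
  (forall j j' l, (0 < j <= j')%N -> n = (j' + l)%N -> (k <= l)%N ->
     (level_bound k j' l)%:R <= theta j * ('C(n, k) * odd_fact k)%:R \/
     (rising (2 * l) n k)%:R <= theta j * (k`! * ('C(n, k) * odd_fact k))%:R) ->
  M \in pm A ->
  #|pm A|%:R * (\sum_(N in pm A) (kpow (pm A) (overlap R (n - k)) t M N
     / ('C(n, k) * odd_fact k)%:R ^+ t) ^+ 2)
  <= \sum_(j < n.+1) ('C('C(n.*2, 2), j))%:R * theta j ^+ (2 * t).
Proof.
move=> cA kn th0 thp hth MA; apply: le_trans (overlap_spectrum (2 * t) cA kn th0 thp hth).
have [e [d ed]] := eigenbasis_exists (pm A) (overlap_sym R (n - k)).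
under eq_bigr do rewrite expr_div_n -exprM [(t * 2)%N]mulnC.
rewrite -!mulr_suml (kpow_sqr ed) // mulrA ler_wpM2r ?invr_ge0 ?exprn_ge0 //.
rewrite (eq_bigr (fun=> kpow (pm A) (overlap R (n - k)) (t + t) M M)).
  by rewrite sumr_const mulr_natl.
by move=> N NA; rewrite mul2n -addnn (kpow_diag_const _ _ NA MA).
Qed.

End Relabelling.

(** * The matching walk *)

Section MatchingWalk.
Context (R : realType) (n k : nat) (kn : (k <= n)%N).
Local Notation T := 'I_(2 * n).
Local Notation pm := perfect_matchings.
Local Notation A := [set: T].
Implicit Types (M N S G : {set {set T}}) (x y z : matching n).

Let cA : #|A| = (2 * n)%N.
Proof. by rewrite cardsT card_ord. Qed.

Let c : R := ('C(n, k) * odd_fact k)%:R.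

Let c_gt0 : 0 < c.
Proof. by rewrite ltr0n muln_gt0 bin_gt0 kn odd_fact_gt0. Qed.

Lemma matching_pm x : val x \in pm A.
Proof. by rewrite inE; exact: valP. Qed.

Lemma card_matching_val x : #|val x| = n.
Proof.
by have := pm_card (matching_pm x); rewrite cA => /eqP; rewrite eqn_pmul2l // => /eqP.
Qed.

Lemma big_matching (F : {set {set T}} -> R) :
  \sum_(x : matching n) F (val x) = \sum_(M in pm A) F M.
Proof.
rewrite [RHS](reindex_omap (fun x : matching n => val x)
  (fun M => insub M : option (matching n))).
  by apply: eq_bigl => x; rewrite matching_pm valK eqxx.
by move=> M MA; have MA' := MA; rewrite inE in MA'; rewrite insubT.
Qed.

Lemma card_matching : #|{: matching n}| = #|pm A|.
Proof. by rewrite card_sub; apply: eq_card => M; rewrite !inE. Qed.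

Lemma card_matching_gt0 : (0 < #|pm A|)%N.
Proof. by rewrite (card_pm cA) odd_fact_gt0. Qed.

(* The k broken pairs S can produce M' exactly when the kept pairs M :\: S lie
   in M', so the number of choices of S counts the (n - k)-subsets of M :&: M'. *)
Lemma matching_stepE x y :
  matching_step R k x y = overlap R (n - k) (val x) (val y) / c.
Proof.
set M := val x; set M' := val y.
have MA : M \in pm A := matching_pm x; have M'A : M' \in pm A := matching_pm y.
have cM : #|M| = n := card_matching_val x.
have inner S : S \subset M -> #|S| = k ->
  \sum_N uniform_pmf R (pm (cover S)) N * (M' == (M :\: S) :|: N)%:R
    = (M :\: S \subset M')%:R / (odd_fact k)%:R.
  move=> SM cS; have Spm := pm_sub MA SM.
  have MSpm := pmD MA Spm SM.
  have cpm : #|pm (cover S)| = odd_fact k.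
    by apply: card_pm; rewrite (pm_card Spm) cS.
  have dMS : [disjoint A :\: cover S & cover S] by rewrite disjoints_subset subsetDr.
  have [MSM'|MSM'] := boolP (M :\: S \subset M'); last first.
    rewrite mul0r big1 // => N _; case: eqP => [E|_]; last by rewrite mulr0.
    by case/negP: MSM'; rewrite E subsetUl.
  have Npm : M' :\: (M :\: S) \in pm (cover S).
    have := pmD M'A MSpm MSM'.
    by rewrite (setDDr A) setDv set0U setTI.
  rewrite (bigD1 (M' :\: (M :\: S))) //= big1 ?addr0.
    rewrite /uniform_pmf Npm cpm setUD_sub // eqxx.
    by rewrite mulr1.
  move=> N NE; rewrite /uniform_pmf; have [NS|] := boolP (N \in _); last by rewrite !mul0r.
  case: eqP => [E|_]; last by rewrite mulr0.
  case/eqP: NE; rewrite E setDUl setDv set0U; apply/esym/setDidPl.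
  by rewrite disjoint_sym; exact: pm_disj MSpm NS dMS.
have cSk : #|[set S' : {set {set T}} | (S' \subset M) && (#|S'| == k)]| = 'C(n, k).
  by rewrite cards_draws cM.
rewrite /matching_step.
transitivity (\sum_(S : {set {set T}} | (S \subset M) && (#|S| == k))
    (M :\: S \subset M')%:R / c).
  rewrite [RHS]big_mkcond; apply: eq_bigr => S _.
  rewrite {1}/uniform_pmf cSk inE; case: ifP => [/andP[SM /eqP cS]|]; last by rewrite !mul0r.
  by rewrite inner // /c natrM invfM mul1r mulrCA.
rewrite -mulr_suml; congr (_ / _); rewrite /overlap -cards_draws -sum1dep_card natr_sum.
rewrite (reindex_onto (fun G => M :\: G) (fun S => M :\: S)) /=; last first.
  by move=> S /andP[SM _]; rewrite setD_sub_self.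
rewrite [RHS]big_mkcond [LHS]big_mkcond; apply: eq_bigr => G _ /=.
rewrite subsetDl subsetI /=.
have [GM|GM] := boolP (G \subset M); last first.
  case: ifP => // /andP[_ /eqP E]; case/negP: GM.
  by rewrite -E subsetDl.
rewrite setD_sub_self // eqxx andbT cardsDS // cM /=.
have gn : (#|G| <= n)%N by apply: (leq_trans (subset_leq_card GM)); rewrite cM.
have -> : ((n - #|G|)%N == k) = (#|G| == (n - k)%N).
  by apply/eqP/eqP; move: gn kn; clear; lia.
by case: (#|G| == _); case: (G \subset M').
Qed.

Lemma iter_stepE t x y :
  iter_step (@matching_step R n k) t x y
    = kpow (pm A) (overlap R (n - k)) t (val x) (val y) / c ^+ t.
Proof.
elim: t x y => [|t IH] x y /=; first by rewrite divr1 val_eqE.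
rewrite -(big_matching (fun N => overlap R (n - k) (val x) N *
   kpow (pm A) (overlap R (n - k)) t N (val y))) mulr_suml.
apply: eq_bigr => z _; rewrite matching_stepE IH exprS invfM; ring.
Qed.

Lemma overlap_sum M : M \in pm A -> \sum_(N in pm A) overlap R (n - k) M N = c.
Proof.
move=> MA; have := kact_overlap A (n - k) (fun=> 1 : R) M.
rewrite /kact; under eq_bigr do rewrite mulr1.
move=> ->; rewrite (eq_bigr (fun=> (odd_fact k)%:R)) => [|G /andP[GM /eqP cG]].
  have cM : #|M| = n.
    by have := pm_card MA; rewrite cA => /eqP; rewrite eqn_pmul2l // => /eqP.
  by rewrite sumr_const -cardsE cards_draws -mulrnA mulnC cM bin_sub.
rewrite /hat sumr_const -cardsE (card_pm_ext MA GM cA) cG.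
by rewrite subKn.
Qed.

Lemma iter_step_sum t x : \sum_y iter_step (@matching_step R n k) t x y = 1.
Proof.
elim: t x => [|t IH] x /=.
  rewrite (bigD1 x) //= eqxx big1 ?addr0 // => y; rewrite eq_sym => /negbTE ->.
  by [].
rewrite exchange_big /=; under eq_bigr do rewrite -mulr_sumr IH mulr1 matching_stepE.
rewrite -mulr_suml (big_matching (fun N => overlap R (n - k) (val x) N)).
by rewrite overlap_sum ?matching_pm // divff // gt_eqF.
Qed.

Lemma matching_piE x : matching_pi R x = #|pm A|%:R^-1.
Proof. by rewrite /matching_pi /uniform_pmf inE cardsT card_matching mul1r. Qed.

Lemma tv_dist_le (O : finType) (mu nu : O -> R) : tv_dist mu nu <= \sum_y `|mu y - nu y|.
Proof.
apply: bigmax_le; first by apply: sumr_ge0.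
move=> B _; rewrite /pr -sumrB (le_trans (ler_norm_sum _ _ _)) //.
by rewrite [leRHS](bigID (mem B)) /= lerDl sumr_ge0.
Qed.

(** Cauchy-Schwarz bounds the squared l1 distance by [#|pm A|] times the sum of the squared
    transition probabilities, minus 1. This 1 cancels the term [j = 0] of the trace bound. *)
Lemma worst_tv_sqr_le (s : R) (theta : nat -> R) :
  (0 < k)%N -> theta 0 = 1 -> (forall j, 0 <= theta j) ->
  (forall j j' l, (0 < j <= j')%N -> n = (j' + l)%N -> (k <= l)%N ->
     (level_bound k j' l)%:R <= theta j * c \/
     (rising (2 * l) n k)%:R <= theta j * (k`! * ('C(n, k) * odd_fact k))%:R) ->
  worst_tv (@matching_step R n k) (@matching_pi R n) s ^+ 2
    <= \sum_(1 <= j < n.+1) ('C('C(n.*2, 2), j))%:R * theta j ^+ (2 * Num.truncn s).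
Proof.
move=> k0 th0 thp hth; set t := Num.truncn s; set B := \sum_(1 <= j < _) _.
have B0 : 0 <= B by apply: sumr_ge0 => j _; rewrite mulr_ge0 ?exprn_ge0.
rewrite -[leRHS]sqr_sqrtr // lerXn2r ?nnegrE ?sqrtr_ge0 //.
  by rewrite /worst_tv; apply: bigmax_ge_id.
apply: bigmax_le; first exact: sqrtr_ge0.
move=> x _; apply: le_trans (tv_dist_le _ _) _.
rewrite -(@ger0_norm _ (\sum_y _)) ?sumr_ge0 // -sqrtr_sqr ler_wsqrtr //.
apply: le_trans (sqr_sum_le _ _) _.
have N0 : #|pm A|%:R != 0 :> R by rewrite pnatr_eq0 -lt0n card_matching_gt0.
have kn' : (0 < k <= n)%N by rewrite k0.
have := kpow_diag_le t cA kn' th0 thp hth (matching_pm x).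
rewrite -(big_mkord xpredT (fun j => ('C('C(n.*2, 2), j))%:R * theta j ^+ (2 * t))).
rewrite big_ltn // th0 expr1n mulr1 bin0 -/B -lerBlDl; apply: le_trans.
rewrite -(big_matching (fun N => (kpow _ _ t _ N / _) ^+ 2)).
rewrite cardsE card_matching.
under eq_bigr do rewrite real_normK ?num_real // matching_piE.
set P := iter_step _ t x.
have -> : \sum_y (P y - #|pm A|%:R^-1) ^+ 2
   = \sum_y P y ^+ 2 - #|pm A|%:R^-1.
  under eq_bigr do rewrite sqrrB.
  rewrite big_split sumrB /= sumrMnl -mulr_suml iter_step_sum sumr_const.
  rewrite card_matching -[_ *+ #|_|]mulr_natr.
  by field.
rewrite mulrBr divff // lerB // ler_wpM2l // le_eqVlt; apply/orP; left; apply/eqP.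
by apply: eq_bigr => y _; rewrite /P iter_stepE.
Qed.

End MatchingWalk.

(** * Retained pairs and the lower bound *)

Section Retention.
Context (R : realType) (n k : nat).
Local Notation T := 'I_(2 * n).
Local Notation pm := perfect_matchings.
Local Notation A := [set: T].
Implicit Types (M N S G H C : {set {set T}}) (x y z : matching n).
Hypotheses (k2 : (2 <= k)%N) (kn2 : (k + 2 <= n)%N).

Let kn : (k <= n)%N.
Proof. by rewrite (leq_trans _ kn2) ?leq_addr. Qed.

Let cA : #|A| = (2 * n)%N.
Proof. by rewrite cardsT card_ord. Qed.

Local Notation P := (matching_step R k).

Lemma sum_subset_card (I : finType) (H : {set I}) (phi : nat -> nat) :
  (\sum_(H1 : {set I} | H1 \subset H) phi #|H1|
    = \sum_(i < #|H|.+1) 'C(#|H|, i) * phi i)%N.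
Proof.
rewrite (partition_big (fun H1 : {set I} => inord #|H1| : 'I_#|H|.+1) xpredT) //=.
apply: eq_bigr => i _; rewrite -cards_draws -sum1dep_card big_distrl /=.
have ino (H1 : {set I}) : H1 \subset H -> ((inord #|H1| : 'I_#|H|.+1) == i) = (#|H1| == i).
  by move=> H1H; rewrite -val_eqE /= inordK // ltnS; exact: subset_leq_card.
apply: eq_big => [H1|H1 /andP[H1H]]; last by rewrite ino // mul1n => /eqP ->.
by have [H1H|] := boolP (H1 \subset H); rewrite //= ino.
Qed.

(** [i] is the number of pairs of [H] that are not broken; the remaining [#|H| - i] have to be
    re-formed. *)
Lemma sum_keep x H : H \subset val x -> (#|H| <= k)%N -> (#|H| <= n - k)%N ->
  (\sum_(G : {set {set T}} | (G \subset val x) && (#|G| == (n - k)%N))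
      odd_fact (n - #|G :|: H|) =
   \sum_(i < #|H|.+1) 'C(#|H|, i) *
      ('C(n - #|H|, n - k - i) * odd_fact (k + i - #|H|)))%N.
Proof.
move=> Hx Hk Hnk.
rewrite -(@sum_subset_card _ H (fun i => 'C(n - #|H|, n - k - i) * odd_fact (k + i - #|H|))%N).
rewrite (partition_big (fun G => G :&: H) (fun H1 => H1 \subset H)) /=; last first.
  by move=> G _; exact: subsetIr.
apply: eq_bigr => H1 H1H.
have cx : #|val x| = n := card_matching_val x.
have H1i := subset_leq_card H1H.
rewrite (eq_bigr (fun=> odd_fact (k + #|H1| - #|H|))) => [|G /andP[/andP[_ /eqP cG] /eqP GH]].
  rewrite sum_nat_const; congr (_ * _)%N.
  transitivity #|[set G : {set {set T}} |
     [&& H1 \subset G, G \subset (val x :\: H) :|: H1 & #|G| == (n - k)%N]]|.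
    apply: eq_card => G; rewrite [RHS]inE [LHS]inE /=.
    apply/idP/idP.
      case/andP => /andP[Gx ->] /eqP <-; rewrite subsetIl andbT /=.
      apply/subsetP => g gG; rewrite !inE gG (subsetP Gx) //=.
      by case: (g \in H).
    case/and3P => H1G GxH ->; rewrite andbT; apply/andP; split.
      apply: (subset_trans GxH); rewrite subUset subsetDl /=.
      exact: subset_trans Hx.
    apply/eqP/setP => g; rewrite !inE; apply/andP/idP => [[gG gH]|gH1].
      by have := subsetP GxH _ gG; rewrite !inE gH.
    by rewrite (subsetP H1G) // (subsetP H1H).
  rewrite card_between ?subsetUr //; last exact: leq_trans Hnk.
  have -> : (#|(val x :\: H) :|: H1| = n - #|H| + #|H1|)%N.
    rewrite cardsU cardsDS // cx (_ : _ :&: _ = set0) ?cards0 ?subn0 //.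
    apply/setP => g; rewrite !inE; apply/negP => /andP[/andP[gH _]] /(subsetP H1H).
    by rewrite (negbTE gH).
  by rewrite addnK.
congr odd_fact; rewrite cardsU GH cG; move: H1i Hk Hnk kn; clear; lia.
Qed.

Lemma step_keep x H : H \subset val x ->
  \sum_y P x y * (H \subset val y)%:R =
  (\sum_(G : {set {set T}} | (G \subset val x) && (#|G| == (n - k)%N))
      odd_fact (n - #|G :|: H|))%:R / ('C(n, k) * odd_fact k)%:R.
Proof.
move=> Hx; under eq_bigr do rewrite matching_stepE // mulrAC.
rewrite -mulr_suml; congr (_ / _).
rewrite (big_matching (fun N => overlap R (n - k) (val x) N * (H \subset N)%:R)).
have xA := matching_pm x.
transitivity (kact (pm A) (overlap R (n - k)) (fun N => (H \subset N)%:R) (val x)).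
  by [].
rewrite kact_overlap natr_sum; apply: eq_bigr => G /andP[Gx _].
have GHx : G :|: H \subset val x by rewrite subUset Gx.
rewrite -(card_pm_ext xA GHx cA) /hat -natr_sum -sum1dep_card big_mkcondr /=.
rewrite [in RHS]big_mkcondr /=; congr _%:R; apply: eq_bigr => N NA.
by rewrite subUset; case: (G \subset N).
Qed.

(* The probabilities that one, respectively two, given pairs survive a step. *)
Definition keep1 : R := 1 - k%:R / n%:R + k%:R / n%:R / (2 * k%:R - 1).

Definition keep2 : R :=
  ((n%:R - k%:R) * (n%:R - k%:R - 1) + 2 * k%:R * (n%:R - k%:R) / (2 * k%:R - 1)
   + k%:R * (k%:R - 1) / ((2 * k%:R - 1) * (2 * k%:R - 3))) / (n%:R * (n%:R - 1)).

Let n0 : n%:R != 0 :> R.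
Proof. by rewrite pnatr_eq0; move: kn2; clear; lia. Qed.

Let of1 : (odd_fact k)%:R = (2 * k%:R - 1) * (odd_fact (k - 1))%:R :> R.
Proof.
case: (k) k2 => // k' _; rewrite subn1 /= natrM -mul2n; congr (_ * _).
by rewrite -[(2 * k').+1%:R]natr1 natrM -[k'.+1%:R]natr1; ring.
Qed.

Let of2 : (odd_fact (k - 1))%:R = (2 * k%:R - 3) * (odd_fact (k - 2))%:R :> R.
Proof.
case: (k) k2 => // -[//|k'] _; rewrite subn1 subn2 /= natrM -mul2n; congr (_ * _).
by rewrite -[(2 * k').+1%:R]natr1 natrM -[k'.+2%:R]natr1 -[k'.+1%:R]natr1; ring.
Qed.

Let k1 : 2 * k%:R - 1 != 0 :> R.
Proof. by rewrite subr_eq0 -natrM (eqr_nat R _ 1); move: k2; clear; lia. Qed.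

Let k3 : 2 * k%:R - 3 != 0 :> R.
Proof. by rewrite subr_eq0 -natrM (eqr_nat R _ 3); move: k2; clear; lia. Qed.

Let n1 : n%:R - 1 != 0 :> R.
Proof. by rewrite subr_eq0 (eqr_nat R _ 1); move: kn2 k2; clear; lia. Qed.

Let C0 : 'C(n, k)%:R != 0 :> R.
Proof. by rewrite pnatr_eq0 -lt0n bin_gt0. Qed.

Let O2 : (odd_fact (k - 2))%:R != 0 :> R.
Proof. by rewrite pnatr_eq0 -lt0n odd_fact_gt0. Qed.

Let bin_down p q : (0 < p)%N -> (q <= p)%N ->
  'C(p.-1, q)%:R = (p - q)%:R / p%:R * 'C(p, q)%:R :> R.
Proof.
move=> p0 qp; rewrite mulrAC -[(p - q)%:R * _]natrM -mul_bin_down natrM mulrAC divff ?mul1r //.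
by rewrite pnatr_eq0 -lt0n.
Qed.

Let bin_diag p q : (0 < p)%N ->
  'C(p.-1, q)%:R = q.+1%:R / p%:R * 'C(p, q.+1)%:R :> R.
Proof.
move=> p0; rewrite mulrAC -[q.+1%:R * _]natrM -mul_bin_diag natrM mulrAC divff ?mul1r //.
by rewrite pnatr_eq0 -lt0n.
Qed.

Lemma step_keep1 x (e : {set T}) : e \in val x ->
  \sum_y P x y * (e \in val y)%:R = keep1.
Proof.
move=> ex; have := @step_keep x [set e]; rewrite sub1set => /(_ ex).
under eq_bigr do rewrite sub1set.
move=> ->; rewrite sum_keep ?sub1set // ?cards1; try by move: kn2 k2; clear; lia.
rewrite !big_ord_recl big_ord0 /= /bump /= bin0 bin1 !mul1n addn0 subn0 addn0 addnK.
rewrite natrD !natrM -[RHS]/keep1 subn1.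
rewrite bin_down ?leq_subr; try by move: kn2; clear; lia.
have -> : (n - k - 1 = (n - k).-1)%N by rewrite subn1.
rewrite (bin_diag (n - k).-1) ?(ltn_predK (m := 0)); try by move: kn2; clear; lia.
rewrite bin_sub // subKn // natrB // -?subn1 of1 of2 /keep1.
by field; rewrite k1 k3 n0 C0 O2.
Qed.

Lemma step_keep2 x (e e' : {set T}) : e \in val x -> e' \in val x -> e != e' ->
  \sum_y P x y * ((e \in val y) && (e' \in val y))%:R = keep2.
Proof.
move=> ex e'x ee'; have := @step_keep x [set e; e'].
rewrite subUset !sub1set ex e'x => /(_ isT).
under eq_bigr do rewrite subUset !sub1set.
have c2 : #|[set e; e']| = 2 by rewrite cards2 ee'.
move=> ->; rewrite sum_keep ?subUset ?sub1set ?ex ?e'x // c2; try by move: kn2 k2; clear; lia.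
rewrite !big_ord_recl big_ord0 /= /bump /= bin0 bin1 binn !mul1n !addn0 subn0.
rewrite (_ : k + (1 + 0) - 2 = k - 1)%N; last by move: k2; clear; lia.
rewrite (_ : k + (1 + (1 + 0)) - 2 = k)%N; last by move: k2; clear; lia.
rewrite !natrD !natrM subn2.
have B1 : 'C(n.-1, n - k)%:R = k%:R / n%:R * 'C(n, k)%:R :> R.
  by rewrite bin_down ?leq_subr; [rewrite subKn // bin_sub|move: kn2; clear; lia|].
have B1' : 'C(n.-1, (n - k).-1)%:R = (n - k)%:R / n%:R * 'C(n, k)%:R :> R.
  rewrite bin_diag; last by move: kn2; clear; lia.
  by rewrite prednK ?bin_sub // subn_gt0; move: kn2; clear; lia.
have nE1 : (n.-1)%:R = n%:R - 1 :> R by rewrite -subn1 natrB //; move: kn2; clear; lia.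
have B2 : 'C(n.-2, n - k)%:R = (k%:R - 1) / (n%:R - 1) * 'C(n.-1, n - k)%:R :> R.
  rewrite bin_down; try by move: kn2 k2; clear; lia.
  rewrite nE1; congr (_ / _ * _); rewrite -(natrB _ (ltnW k2)); congr _%:R.
  by move: kn2 k2; clear; lia.
have B2' : 'C(n.-2, n - k - (1 + 0))%:R = k%:R / (n%:R - 1) * 'C(n.-1, (n - k).-1)%:R :> R.
  rewrite (_ : n - k - (1 + 0) = (n - k).-1)%N; last by move: kn2; clear; lia.
  rewrite bin_down; try by move: kn2 k2; clear; lia.
  rewrite nE1; congr (_ / _ * _); congr _%:R.
  by move: kn2 k2; clear; lia.
have B2'' : 'C(n.-2, n - k - (1 + (1 + 0)))%:R
    = ((n - k)%:R - 1) / (n%:R - 1) * 'C(n.-1, (n - k).-1)%:R :> R.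
  rewrite (_ : n - k - (1 + (1 + 0)) = (n - k).-2)%N; last by move: kn2; clear; lia.
  rewrite bin_diag; last by move: kn2; clear; lia.
  rewrite prednK; last by move: kn2; clear; lia.
  rewrite nE1; congr (_ / _ * _); rewrite -subn1 natrB //.
  by move: kn2; clear; lia.
rewrite B2 B2' B2'' B1 B1' natrB // of1 of2 /keep2.
by field; rewrite k1 k3 n0 n1 C0 O2.
Qed.

Lemma step_ge0 x y : 0 <= P x y.
Proof. by rewrite matching_stepE // divr_ge0. Qed.

Lemma step_sum x : \sum_y P x y = 1.
Proof.
rewrite -(iter_step_sum R kn 1 x) /=; apply: eq_bigr => y _.
rewrite (bigD1 y) //= eqxx mulr1 big1 ?addr0 // => z /negbTE zy.
by rewrite zy mulr0.
Qed.

Let cap (C : {set {set T}}) y : R := #|C :&: val y|%:R.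

Let capE C y : cap C y = \sum_(e in C) (e \in val y)%:R.
Proof.
rewrite /cap -natr_sum; congr _%:R; rewrite -sum1_card big_mkcond [RHS]big_mkcond.
by apply: eq_bigr => e _; rewrite inE; case: (e \in C); case: (e \in val y).
Qed.

Lemma step_cap x C : C \subset val x -> \sum_y P x y * cap C y = #|C|%:R * keep1.
Proof.
move=> /subsetP Cx; under eq_bigr do rewrite capE mulr_sumr.
rewrite exchange_big /= (eq_bigr (fun=> keep1)) => [|e /Cx ex]; last exact: step_keep1.
by rewrite sumr_const mulr_natl.
Qed.

Lemma step_cap2 x C : C \subset val x ->
  \sum_y P x y * (cap C y * (cap C y - 1)) = #|C|%:R * (#|C|%:R - 1) * keep2.
Proof.
move=> /subsetP Cx.
transitivity (\sum_y \sum_(e in C) \sum_(e' in C | e' != e)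
    P x y * ((e \in val y) && (e' \in val y))%:R).
  apply: eq_bigr => y _; rewrite {1}capE [X in _ * X]mulr_suml mulr_sumr; apply: eq_bigr => e eC.
  rewrite -mulr_sumr; congr (_ * _); rewrite capE (bigD1 e) //=.
  case: (e \in val y); last by rewrite mul0r big1.
  by rewrite mul1r addrAC subrr add0r; apply: eq_bigl => e'; rewrite andbC.
rewrite exchange_big /=.
rewrite (eq_bigr (fun=> (#|C|%:R - 1) * keep2)) => [|e eC].
  by rewrite sumr_const -[LHS]mulr_natl mulrA.
rewrite exchange_big /= (eq_bigr (fun=> keep2)) => [|e' /andP[e'C ee']]; last first.
  by apply: step_keep2; [exact: Cx|exact: Cx|rewrite eq_sym].
rewrite sumr_const -[LHS]mulr_natl; congr (_ * _).
have -> : #|[pred e' | e' \in C & e' != e]| = #|C :\ e|.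
  by apply: eq_card => e'; rewrite !inE andbC.
by rewrite (cardsD1 e C) eC natrD addrAC subrr add0r.
Qed.

(* Dropping at each step the pairs of C that are missing only makes the event
   likelier; the number of pairs never dropped has its first two factorial moments
   multiplied by keep1 and keep2, and Chebyshev's inequality applies to it. *)
Lemma iter_step_few (a m : R) t x C : a < m -> C \subset val x ->
  \sum_y iter_step (@matching_step R n k) t x y * (cap C y < a)%R%:R
  <= (keep2 ^+ t * (#|C|%:R * (#|C|%:R - 1)) + (1 - 2 * m) * (keep1 ^+ t * #|C|%:R)
      + m ^+ 2) / (m - a) ^+ 2.
Proof.
move=> am; have ma : 0 < (m - a) ^+ 2 by rewrite exprn_gt0 // subr_gt0.
elim: t x C => [|t IH] x C Cx /=.
  rewrite (bigD1 x) //= eqxx mul1r big1 ?addr0 => [|y]; last first.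
    by rewrite eq_sym => /negbTE ->; rewrite mul0r.
  rewrite /cap (setIidPl Cx) !mul1r.
  (* The bound is a mean of (X - m)^2, X the number of pairs never dropped, written as X (X - 1) +
     (1 - 2m) X + m^2. *)
  have -> : #|C|%:R * (#|C|%:R - 1) + (1 - 2 * m) * #|C|%:R + m ^+ 2
    = (#|C|%:R - m) ^+ 2 :> R by ring.
  rewrite ler_pdivlMr //; case: ltP => Ca; last by rewrite mul0r sqr_ge0.
  rewrite mul1r; nra.
under eq_bigr do rewrite mulr_suml.
rewrite exchange_big /=.
pose H (z : R) := (keep2 ^+ t * (z * (z - 1)) + (1 - 2 * m) * (keep1 ^+ t * z)
      + m ^+ 2) / (m - a) ^+ 2.
apply: (@le_trans _ _ (\sum_z P x z * H (cap C z))).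
  apply: ler_sum => z _; under eq_bigr do rewrite -mulrA.
  rewrite -mulr_sumr; apply: ler_wpM2l; first exact: step_ge0.
  apply: le_trans (IH z (C :&: val z) (subsetIr _ _)).
  apply: ler_sum => y _; apply: ler_wpM2l.
    by rewrite iter_stepE // divr_ge0 ?exprn_ge0 // kpow_ge0.
  have [Ca|_] := boolP (cap C y < a); last exact: ler0n.
  suff -> : cap (C :&: val z) y < a by [].
  apply: le_lt_trans Ca.
  by rewrite ler_nat subset_leq_card // setSI // subsetIl.
rewrite le_eqVlt; apply/orP; left; apply/eqP.
have HE z : P x z * H (cap C z) =
   ((keep2 ^+ t * (P x z * (cap C z * (cap C z - 1)))
     + (1 - 2 * m) * (keep1 ^+ t * (P x z * cap C z))) + m ^+ 2 * P x z) / (m - a) ^+ 2.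
  by rewrite /H; ring.
under eq_bigr do rewrite HE.
rewrite -mulr_suml; congr (_ / _); rewrite !big_split /= -!mulr_sumr.
rewrite step_sum step_cap // step_cap2 // !exprS; ring.
Qed.

(** The test event is that fewer than [m / 2] initial pairs are present. By [keep2 <= keep1 ^+ 2]
    the number of pairs never dropped, of mean [m], has variance at most [m], so Chebyshev gives the
    event probability at most 4 / m. Under the uniform law the mean number of initial pairs is n /
    (2n - 1) <= 1, and Markov bounds the complement by 2 / m. *)
Lemma worst_tv_ge (s : R) (m := n%:R * keep1 ^+ Num.truncn s) :
  keep2 <= keep1 ^+ 2 -> 0 <= keep2 -> 0 < m ->
  1 - 6 / m <= worst_tv (@matching_step R n k) (@matching_pi R n) s.
Proof.
move=> r2 r0 m0; set t := Num.truncn s in m m0 *.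
have [M MA] := card_gt0P (card_matching_gt0 n).
have MA' : is_perfect_matching A M by rewrite inE in MA.
have x : matching n := Sub M MA'.
pose B : {set matching n} := [set y | (cap (val x) y < m / 2)%R].
have am : m / 2 < m by lra.
have P1 : pr (iter_step (@matching_step R n k) t x) B <= 4 / m.
  have := iter_step_few t am (subxx (val x)).
  have -> : \sum_y iter_step (@matching_step R n k) t x y * (cap (val x) y < m / 2)%R%:R
    = pr (iter_step (@matching_step R n k) t x) B.
    rewrite /pr [RHS]big_mkcond; apply: eq_bigr => y _; rewrite inE.
    by case: ifP => _; rewrite ?mulr1 ?mulr0.
  move/le_trans; apply; rewrite card_matching_val.
  rewrite ler_pdivrMr ?exprn_gt0 ?subr_gt0 //.
  have -> : 4 / m * (m - m / 2) ^+ 2 = m by field; rewrite gt_eqF.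
  have nn : 1 <= n%:R :> R by rewrite (ler_nat R 1); move: kn2; clear; lia.
  have rt : keep2 ^+ t <= (keep1 ^+ t) ^+ 2.
    by rewrite -exprM mulnC exprM lerXn2r ?nnegrE ?sqr_ge0.
  have rt0 : 0 <= keep2 ^+ t by exact: exprn_ge0.
  have : keep2 ^+ t * (n%:R * (n%:R - 1)) <= m ^+ 2.
    have -> : m ^+ 2 = n%:R ^+ 2 * (keep1 ^+ t) ^+ 2 by rewrite -[RHS]exprMn.
    rewrite [leLHS]mulrC; apply: ler_pM => //.
      by rewrite mulr_ge0 ?subr_ge0.
    by rewrite expr2 ler_wpM2l // gerBl.
  rewrite [keep1 ^+ t * n%:R]mulrC -/m.
  have -> : (1 - 2 * m) * m = m - 2 * m ^+ 2 by ring.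
  by move=> h; nra.
have P2 : 1 - 2 / m <= pr (@matching_pi R n) B.
  have pi1 : pr (@matching_pi R n) B + pr (@matching_pi R n) (~: B) = 1.
    transitivity (\sum_y @matching_pi R n y).
      rewrite [RHS](bigID (mem B)) /=; congr (_ + _).
      by apply: eq_bigl => y; rewrite inE.
    under eq_bigr do rewrite matching_piE.
    by rewrite sumr_const card_matching -[LHS]mulr_natl divff // pnatr_eq0 -lt0n card_matching_gt0.
  suff : pr (@matching_pi R n) (~: B) <= 2 / m by lra.
  apply: (@le_trans _ _ (\sum_y #|pm A|%:R^-1 * (cap (val x) y / (m / 2)))).
    rewrite /pr big_mkcond; apply: ler_sum => y _; rewrite matching_piE !inE -leNgt.
    case: ifP => [my|_]; last first.
      by rewrite mulr_ge0 ?invr_ge0 ?ler0n // divr_ge0 ?ler0n // divr_ge0 // ltW.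
    by rewrite ler_peMr ?invr_ge0 // ler_pdivlMr ?mul1r // divr_gt0.
  have -> : \sum_y #|pm A|%:R^-1 * (cap (val x) y / (m / 2))
      = (\sum_y cap (val x) y) / #|pm A|%:R * (2 / m).
    by rewrite !mulr_suml; apply: eq_bigr => y _; field; rewrite gt_eqF //= pnatr_eq0 -lt0n card_matching_gt0.
  have -> : \sum_y cap (val x) y = (n * odd_fact (n - 1))%:R.
    under eq_bigr do rewrite capE.
    rewrite exchange_big /= (eq_bigr (fun=> (odd_fact (n - 1))%:R)) => [|e ex].
      rewrite sumr_const -[LHS]mulr_natl natrM; congr (_%:R * _).
      exact: card_matching_val.
    rewrite (big_matching (fun N => (e \in N)%:R)).
    have ex' : [set e] \subset val x by rewrite sub1set.
    have := card_pm_ext (matching_pm x) ex' cA; rewrite cards1 => <-.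
    rewrite -sum1dep_card natr_sum.
    by rewrite big_mkcondr; apply: eq_bigr => N _; rewrite sub1set; case: ifP.
  rewrite -[leRHS]mul1r ler_wpM2r ?divr_ge0 ?(ltW m0) //.
  rewrite (card_pm cA) ler_pdivrMr ?ltr0n ?odd_fact_gt0 // mul1r ler_nat.
  case: (n) kn2 => [|n' _]; first by rewrite addn2.
  by rewrite subn1 /= leq_mul2r ltnS -addnn leq_addr orbT.
have : `|pr (iter_step (@matching_step R n k) t x) B - pr (@matching_pi R n) B|
    <= worst_tv (@matching_step R n k) (@matching_pi R n) s.
  apply: le_trans (le_bigmax _ _ x).
  exact: (le_bigmax _ (fun B => `|pr _ B - pr _ B|) B).
rewrite ler_norml => /andP[+ _].
have -> : 1 - 6 / m = (1 - 2 / m) - 4 / m by lra.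
lra.
Qed.
End Retention.

(** * Numerical bounds *)

From mathcomp Require Import all_classical all_reals all_analysis.
Import numFieldNormedType.Exports.

Lemma ffact_ratio_le l n i s : (l <= n)%N ->
  ((l - i) ^_ s * n ^ s <= l ^ s * (n - i) ^_ s)%N.
Proof.
move=> ln; rewrite !ffact_prod.
elim: s => [|s IH]; first by rewrite !big_ord0.
rewrite !big_ord_recr /= !expnS.
have h : ((l - i - s) * n <= l * (n - i - s))%N.
  rewrite !mulnBl !mulnBr [(l * n)%N]mulnC; apply: leq_sub.
    by apply: leq_sub => //; rewrite mulnC leq_mul2l ln orbT.
  by rewrite [(l * s)%N]mulnC leq_mul2l ln orbT.
rewrite [X in (X <= _)%N](_ : _ = (\prod_(i0 < s) (l - i - i0) * n ^ s * ((l - i - s) * n))%N);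
  last by ring.
rewrite [X in (_ <= X)%N](_ : _ = (l ^ s * \prod_(i0 < s) (n - i - i0) * (l * (n - i - s)))%N);
  last by ring.
exact: leq_mul.
Qed.

Lemma bin_odd_fact_le k i : (i <= k)%N ->
  ('C(k, i) * (odd_fact i * odd_fact (k - i)) <= odd_fact k)%N.
Proof.
elim: k i => [|k IH] i; first by rewrite leqn0 => /eqP ->.
rewrite leq_eqVlt => /predU1P[->|]; first by rewrite binn subnn muln1 mul1n.
rewrite ltnS => ik; have kik : (0 < k.+1 - i)%N by rewrite subn_gt0 ltnS.
rewrite -(leq_pmul2l kik) mulnA -mul_bin_down /= subSn //=.
have h : (k.+1 * (k - i).*2.+1 <= (k - i).+1 * k.*2.+1)%N.
  by move: ik; rewrite -!mul2n; clear; nia.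
apply: leq_trans (leq_trans (leq_mul h (IH i ik)) _); rewrite leq_eqVlt; apply/orP; left;
  by apply/eqP; ring.
Qed.

Lemma expRN_ge1B (R : realType) (x : R) : 1 - x <= expR (- x).
Proof. exact: expR_ge1Dx. Qed.

Lemma geometric_tail_le (R : realType) (y : R) m : 0 <= y <= 1 / 2 ->
  \sum_(i < m) y ^+ i <= 2.
Proof.
move=> /andP[y0 y2].
have : (1 - y) * \sum_(i < m) y ^+ i <= 1.
  by have := subrX1 y m; have := exprn_ge0 m y0; nra.
have : 0 <= \sum_(i < m) y ^+ i by apply: sumr_ge0 => i _; exact: exprn_ge0.
by nra.
Qed.

Section LevelBounds.
Context (R : realType) (k j l n : nat).
Hypotheses (k2 : (2 <= k)%N) (nE : n = (j + l)%N) (kl : (k <= l)%N).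
Let a : R := j%:R / n%:R.
Let b : R := l%:R / n%:R.
Let c : R := ('C(n, k) * odd_fact k)%:R.

Let kn : (k <= n)%N. Proof. by rewrite nE (leq_trans kl) ?leq_addl. Qed.
Let n_gt0 : 0 < n%:R :> R.
Proof. by rewrite ltr0n (leq_trans _ kn) // (leq_trans _ k2). Qed.
Let c_gt0 : 0 < c.
Proof. by rewrite ltr0n muln_gt0 bin_gt0 kn odd_fact_gt0. Qed.
Let ab : a + b = 1.
Proof. by rewrite /a /b -mulrDl -natrD -nE divff // gt_eqF. Qed.

(** A hypergeometric weight with ['C(l, k - i)] can exceed the binomial one; the shift to [l - i]
    lets each factor be compared with the matching factor of [(n - i) ^_ (k - i)]. *)
Lemma hypergeometric_le i : (i <= k)%N -> (i <= j)%N ->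
  ('C(l - i, k - i) * 'C(j, i) * n ^ k <= 'C(k, i) * (j ^ i * l ^ (k - i)) * 'C(n, k))%N.
Proof.
move=> ik ij.
have jn : (j <= n)%N by rewrite nE leq_addr.
have ln : (l <= n)%N by rewrite nE leq_addl.
have h1 := ffact_ratio_le i (k - i) ln.
have h2 := ffact_ratio_le 0 i jn; rewrite !subn0 in h2.
have kf : (0 < i`! * (k - i)`!)%N by rewrite muln_gt0 !fact_gt0.
rewrite -(leq_pmul2r kf).
have -> : (n ^ k = n ^ i * n ^ (k - i))%N by rewrite -expnD subnKC.
apply: (@leq_trans (((l - i) ^_ (k - i) * n ^ (k - i)) * (j ^_ i * n ^ i))%N).
  by rewrite -!bin_ffact leq_eqVlt; apply/orP; left; apply/eqP; ring.
apply: leq_trans (leq_mul h1 h2) _.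
rewrite leq_eqVlt; apply/orP; left; apply/eqP.
transitivity (j ^ i * l ^ (k - i) * (n ^_ i * (n - i) ^_ (k - i)))%N; first by ring.
have -> : (n ^_ i * (n - i) ^_ (k - i) = 'C(n, k) * k`!)%N.
  rewrite bin_ffact !ffact_prod -[in RHS](subnKC ik) big_split_ord /=.
  by congr (_ * _)%N; apply: eq_bigr => r _; rewrite subnDA.
rewrite -(bin_fact ik); ring.
Qed.

(** Apart from ['C(k, i)], this is the probability that a uniform matching of 2k points pairs 2i
    given points among themselves. *)
Let w i : R := ('C(k, i) * (odd_fact i * odd_fact (k - i)))%:R / (odd_fact k)%:R.

Lemma level_bound_le :
  (level_bound k j l)%:R / c <= \sum_(i < k.+1) w i * (a ^+ i * b ^+ (k - i)).
Proof.
rewrite /level_bound natr_sum mulr_suml big_mkcond /=; apply: ler_sum => i _.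
have : (i <= k)%N by rewrite -ltnS.
move: (nat_of_ord i) => {}i ik.
have of0 : 0 < (odd_fact k)%:R :> R by rewrite ltr0n odd_fact_gt0.
case: ifP => ij; last first.
  by apply: mulr_ge0; [exact: divr_ge0|apply: mulr_ge0; apply: exprn_ge0; exact: divr_ge0].
rewrite ler_pdivrMr // /w /a /b !expr_div_n.
have nk : n%:R ^+ k != 0 :> R by rewrite expf_neq0 // gt_eqF.
rewrite [leRHS](_ : _ = ('C(k, i) * (j ^ i * l ^ (k - i)) * 'C(n, k))%:R / n%:R ^+ k
    * (odd_fact i * odd_fact (k - i))%:R); last first.
  rewrite /c !natrM !natrX -(subnKC ik) exprD addKn; field.
  by rewrite !expf_neq0 ?gt_eqF //= subnKC // gt_eqF.
rewrite [leLHS](_ : _ = ('C(l - i, k - i) * 'C(j, i))%:R * (odd_fact i * odd_fact (k - i))%:R);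
  last by rewrite !natrM; ring.
rewrite ler_wpM2r // ler_pdivlMr ?exprn_gt0 // -natrX -natrM ler_nat.
exact: hypergeometric_le.
Qed.

(* The expected number of broken pairs that are not re-formed in a step. *)
Definition rate : R := k%:R - k%:R / (2 * k%:R - 1).

Let k2R : 2 <= k%:R :> R. Proof. by rewrite (ler_nat R 2). Qed.

Lemma rate_ge : 4 / 3 <= rate.
Proof.
rewrite /rate lerBrDl -lerBrDr ler_pdivrMr; last by have := k2R; lra.
by have := k2R; nra.
Qed.

(** The terms [i = 0] and [i = 1] produce [rate]. For [i >= 2] the estimate [w i <= 1] and a
    geometric series of ratio [y = a / b <= 1 / 2] leave an error of order a^2. *)
Lemma small_level_bound_le : a <= 1 / 3 ->
  (level_bound k j l)%:R / c <= expR (- (a * rate * (1 - 5 * a))).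
Proof.
move=> a3; apply: le_trans level_bound_le _.
have a0 : 0 <= a by rewrite divr_ge0.
have b0 : 0 < b by have := ab; lra.
pose y := a / b.
have y0 : 0 <= y by rewrite divr_ge0 // ltW.
have yb : y * b = a by rewrite /y divfK // gt_eqF.
have y2 : y <= 1 / 2 by rewrite ler_pdivrMr //; have := ab; lra.
have w0 : w 0 = 1.
  by rewrite /w bin0 subn0 !mul1n divff // pnatr_eq0 -lt0n odd_fact_gt0.
pose a1 : R := k%:R / (2 * k%:R - 1).
have w1 : w 1 = a1.
  rewrite /w /a1 bin1 mul1n subn1; case: (k) k2 => // k' _ /=.
  have o0 : (odd_fact k')%:R != 0 :> R by rewrite pnatr_eq0 -lt0n odd_fact_gt0.
  have q0 : (k'.*2.+1)%:R != 0 :> R by [].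
  have -> : 2 * (k'.+1)%:R - 1 = (k'.*2.+1)%:R :> R.
    by rewrite -[(k'.*2).+1%:R]natr1 -mul2n natrM -[k'.+1%:R]natr1; ring.
  by rewrite !natrM invfM mulrACA divff // mulr1.
have wi i : (i <= k)%N -> w i <= 1.
  move=> ik; rewrite /w ler_pdivrMr ?ltr0n ?odd_fact_gt0 // mul1r ler_nat.
  exact: bin_odd_fact_le.
have E i : (i <= k)%N -> a ^+ i * b ^+ (k - i) = b ^+ k * y ^+ i.
  by move=> ik; rewrite -yb exprMn -[in RHS](subnKC ik) exprD; ring.
have step1 : \sum_(i < k.+1) w i * (a ^+ i * b ^+ (k - i))
    <= b ^+ k * (1 + a1 * y + 2 * y ^+ 2).
  under eq_bigr => i _ do rewrite (E i (leq_ord i)) mulrCA.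
  rewrite -mulr_sumr ler_wpM2l ?exprn_ge0 ?(ltW b0) //.
  case: (k) k2 wi w0 w1 => [|[|k']] // _ wi w0 w1.
  rewrite big_ord_recl big_ord_recl /= w0 mul1r expr0 /bump /= w1 expr1 addrA lerD2l.
  apply: (@le_trans _ _ (y ^+ 2 * \sum_(i < k'.+1) y ^+ i)).
    rewrite mulr_sumr; apply: ler_sum => i _; rewrite -exprD !add1n.
    by rewrite ler_piMl ?exprn_ge0 // wi // ltnS.
  by rewrite mulrC ler_wpM2r ?sqr_ge0 // geometric_tail_le // y0.
apply: le_trans step1 _.
have bk : b ^+ k <= expR (- (k%:R * a)).
  rewrite -mulrN expRM_natl lerXn2r ?nnegrE ?(ltW b0) ?expR_ge0 //.
  by have := expRN_ge1B a; have := ab; lra.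
have ey : 1 + a1 * y + 2 * y ^+ 2 <= expR (a1 * y + 2 * y ^+ 2).
  by rewrite -addrA; exact: expR_ge1Dx.
have a10 : 0 <= a1 by rewrite divr_ge0 //; have := k2R; lra.
have b_ge0 : 0 <= b ^+ k by rewrite exprn_ge0 // ltW.
have p0 : 0 <= 1 + a1 * y + 2 * y ^+ 2.
  by have := sqr_ge0 y; have := mulr_ge0 a10 y0; lra.
apply: le_trans (ler_pM b_ge0 p0 bk ey) _.
rewrite -expRD ler_expR.
have a12 : a1 <= 2 / 3.
  by rewrite /a1 ler_pdivrMr; have := k2R; lra.
have := rate_ge; rewrite /rate -/a1.
have ya : y - a = a * y by rewrite -{1}yb -yb; have := ab; nra.
have y3 : y <= 3 / 2 * a by rewrite /y ler_pdivrMr //; have := ab; nra.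
move=> rk.
have h1 : y ^+ 2 <= 9 / 4 * a ^+ 2 by nra.
have h2 : a1 * (y - a) <= a ^+ 2.
  rewrite ya; nra.
(* The errors, from [h2] and twice [h1], total at most 11/2 a^2; the room is 20/3 = 5 * 4/3, by
   [rate_ge]. *)
have h3 : 20 / 3 * a ^+ 2 <= 5 * a ^+ 2 * (k%:R - a1) by nra.
nra.
Qed.

End LevelBounds.

(** Factor by factor, r < k: the ratio (1 + 2 (1 - a) r) / (2r + 1) is at most 1 - 2a/3 for r >= 1,
    and n / (n - r) is at most 1 + 2K/n. The factor r = 0 gains nothing, whence the exponent [k.-1].
    [K] stays fixed while the induction runs on [k]. *)
Lemma rising_ratio_le (R : realType) (j l n K k : nat) :
  n = (j + l)%N -> (2 * K <= n)%N -> (0 < k <= K)%N ->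
  (rising (2 * l) n k)%:R <=
    expR (- (2 / 3 * (j%:R / n%:R)) + 2 * (K%:R / n%:R)) ^+ k.-1
      * (n ^_ k * odd_fact k)%:R :> R.
Proof.
move=> nE Kn /andP[k0 kK].
set a : R := j%:R / n%:R; set x : R := K%:R / n%:R; set E := expR _.
case: k k0 kK => // k _; elim: k => [|k IH] kK.
  by rewrite /rising big_ord1 muln0 addn0 expr0 mul1r ffactn1 !muln1.
have n0 : 0 < n%:R :> R by rewrite ltr0n; move: Kn kK; clear; lia.
have a0 : 0 <= a by rewrite divr_ge0.
have lE : l%:R = n%:R * (1 - a) :> R.
  by rewrite mulrBr mulr1 /a mulrCA divff ?gt_eqF // mulr1 nE natrD addrAC subrr add0r.
have step : (n + 2 * l * k.+1)%:R <= E * ((n - k.+1) * k.+1.*2.+1)%:R.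
  have kn : (k.+1 <= n)%N by move: Kn kK; clear; lia.
  have kK' : k.+1%:R <= K%:R :> R by rewrite ler_nat ltnW.
  have Kn' : 2 * K%:R <= n%:R :> R by rewrite -natrM ler_nat.
  have k1 : 1 <= k.+1%:R :> R by rewrite (ler_nat R 1).
  rewrite natrD !natrM lE natrB // -[(k.+1.*2).+1%:R]natr1 -mul2n natrM.
  move: (k.+1%:R) kK' k1 => q qK q1.
  have Kx : K%:R = n%:R * x by rewrite /x mulrCA divff ?gt_eqF ?mulr1.
  have x0 : 0 <= x by rewrite divr_ge0.
  have x2 : x <= 1 / 2 by rewrite ler_pdivrMr //; lra.
  have E1 : (1 - 2 / 3 * a) * (1 + 2 * x) <= E.
    rewrite /E expRD; apply: (@le_trans _ _ (expR (- (2 / 3 * a)) * (1 + 2 * x))).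
      by rewrite ler_wpM2r ?expRN_ge1B //; lra.
    by rewrite ler_wpM2l ?expR_ge0 ?expR_ge1Dx.
  have h1 : n%:R <= (1 + 2 * x) * (n%:R - q).
    apply: (@le_trans _ _ ((1 + 2 * x) * (n%:R * (1 - x)))).
      by rewrite mulrCA ler_peMr ?(ltW n0) //; nra.
    by rewrite ler_wpM2l //; lra.
  have h2 : n%:R + 2 * (n%:R * (1 - a)) * q <= n%:R * ((2 * q + 1) * (1 - 2 / 3 * a)).
    have -> : n%:R + 2 * (n%:R * (1 - a)) * q = n%:R * (1 + 2 * (1 - a) * q) by ring.
    by rewrite ler_pM2l //; nra.
  apply: le_trans h2 _.
  have q3 : 0 <= (2 * q + 1) * (1 - 2 / 3 * a).
    apply: mulr_ge0; first by lra.
    suff : a <= 1 by lra.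
    by rewrite ler_pdivrMr // mul1r ler_nat nE leq_addr.
  apply: le_trans (ler_wpM2r q3 h1) _.
  rewrite (_ : (1 + 2 * x) * (n%:R - q) * ((2 * q + 1) * (1 - 2 / 3 * a))
     = (1 - 2 / 3 * a) * (1 + 2 * x) * ((n%:R - q) * (2 * q + 1))); last by ring.
  rewrite ler_wpM2r // mulr_ge0 //; last by lra.
  by lra.
rewrite risingS natrM.
apply: le_trans (ler_pM (ler0n _ _) (ler0n _ _) (IH (ltnW kK)) step) _.
rewrite le_eqVlt; apply/orP; left; apply/eqP.
have -> : odd_fact k.+2 = (k.+1.*2.+1 * odd_fact k.+1)%N by [].
rewrite (ffactnSr n k.+1) -[k.+2.-1]/k.+1 -[k.+1.-1]/k exprS !natrM; ring.
Qed.

Section LargeLevels.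
Context (R : realType) (k j l n : nat) (eps : R).
Hypotheses (k2 : (2 <= k)%N) (nE : n = (j + l)%N) (kn2 : (2 * k <= n)%N).

(** As [rate] is 2 (k - 1) k / (2k - 1), at most 4/3 (k - 1), the exponent 2/3 (k - 1) covers half
    of it; [3 * k <= eps * j] absorbs the correction 2k/n. *)
Lemma large_level_bound_le : 0 <= eps <= 1 -> 3 * k%:R <= eps * j%:R ->
  (rising (2 * l) n k)%:R <=
    expR (- ((1 - eps) * (j%:R / n%:R) * rate R k / 2))
      * (k`! * ('C(n, k) * odd_fact k))%:R.
Proof.
move=> /andP[eps0 e1] kj.
have kk : (0 < k <= k)%N by rewrite leqnn (leq_trans _ k2).
apply: le_trans (rising_ratio_le R nE kn2 kk) _.
have -> : (k`! * ('C(n, k) * odd_fact k) = n ^_ k * odd_fact k)%N.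
  by rewrite -bin_ffact mulnCA mulnA.
rewrite ler_wpM2r // -expRM_natl ler_expR.
have k2R : 2 <= k%:R :> R by rewrite (ler_nat R 2).
have n0 : 0 < n%:R :> R by rewrite ltr0n; move: kn2 k2; clear; lia.
have -> : (k.-1)%:R = k%:R - 1 :> R by rewrite -subn1 natrB // ltnW.
set a := j%:R / n%:R.
have a0 : 0 <= a by rewrite divr_ge0.
have kn : 3 * (k%:R / n%:R) <= eps * a.
  by rewrite /a !mulrA ler_pM2r ?invr_gt0.
have rk : rate R k / 2 <= 2 / 3 * (k%:R - 1).
  rewrite /rate; have -> : k%:R - k%:R / (2 * k%:R - 1)
      = 2 * (k%:R - 1) * (k%:R / (2 * k%:R - 1)) :> R.
    by field; lra.
  have : k%:R / (2 * k%:R - 1) <= 2 / 3 :> R by rewrite ler_pdivrMr; lra.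
  nra.
have r0 : 0 <= rate R k by have := rate_ge R k2; lra.
have h1 : (k%:R - 1) * (2 * (k%:R / n%:R)) <= (k%:R - 1) * (2 / 3 * (eps * a)).
  by apply: ler_wpM2l; lra.
have h2 : (1 - eps) * a * (rate R k / 2) <= (1 - eps) * a * (2 / 3 * (k%:R - 1)).
  by apply: ler_wpM2l => //; rewrite mulr_ge0 // subr_ge0.
nra.
Qed.
End LargeLevels.

(** The left side is one term of the expansion of (1 + x)^N. *)
Lemma bin_mul_exp_le (R : realType) (N j : nat) (x : R) : 0 <= x ->
  'C(N, j)%:R * x ^+ j <= expR (N%:R * x).
Proof.
move=> x0; have [Nj|jN] := ltnP N j.
  by rewrite bin_small // mul0r expR_ge0.
apply: (@le_trans _ _ ((1 + x) ^+ N)).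
  rewrite exprDn (bigD1 (Ordinal (jN : (j < N.+1)%N))) //= expr1n mul1r mulr_natl.
  by rewrite lerDl sumr_ge0 // => i _; rewrite expr1n mul1r mulrn_wge0 ?exprn_ge0.
by rewrite expRM_natl lerXn2r ?nnegrE ?expR_ge0 ?expR_ge1Dx // addr_ge0.
Qed.

Lemma bin_le_exp (N j : nat) : ('C(N, j) <= N ^ j)%N.
Proof.
apply: leq_trans (ffact_le_exp j (leqnn N)).
by rewrite -bin_ffact leq_pmulr ?fact_gt0.
Qed.

(** * Summation over the levels *)

Section UpperBound.
Context (R : realType) (n k : nat) (delta s : R).
Hypotheses (k2 : (2 <= k)%N) (kn2 : (2 * k <= n)%N).
Hypothesis d01 : 0 < delta < 1.
(** [eps] is small enough for (1 - eps) (2 + delta) >= 2 + delta / 2, and [c] makes the correction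
    [5 * a] of the small levels at most [eps] as long as [a <= 2 * c]. *)
Let eps : R := delta / 8.
Let c : R := eps / 10.
Hypothesis kc : 3 * k%:R <= eps * (2 * c * n%:R).
Let L : R := ln n%:R.
Hypothesis sT : (1 + delta / 2) * (n%:R * L / rate R k) <= (Num.truncn s)%:R.
Let rho : R := 2 * expR 1 / c * expR (- (delta / 4 * L)).

Let n0 : 0 < n%:R :> R.
Proof. by rewrite ltr0n; move: kn2 k2; clear; lia. Qed.

Let nL : n%:R = expR L. Proof. by rewrite lnK. Qed.

Let L0 : 0 <= L.
Proof. by rewrite ln_ge0 // (ler_nat R 1); move: kn2 k2; clear; lia. Qed.

(* Up to c n the eigenvalues at level j are about exp (- j rate / n); beyond, only half
   of that decay is available, but then there are only about n^j, and not n^(2j), of them. *)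
Let w (j : nat) : R := if j%:R <= c * n%:R then j%:R else j%:R / 2.

Let theta (j : nat) : R := expR (- ((1 - eps) * w j * (rate R k / n%:R))).

Let eps_b : 0 < eps < 1 / 8. Proof. by rewrite /eps; case/andP: d01 => *; lra. Qed.

Let r0 : 0 < rate R k. Proof. by have := rate_ge R k2; lra. Qed.

Let w_le j : 0 <= w j <= j%:R.
Proof. by rewrite /w; have := ler0n R j; case: ifP => _; lra. Qed.

(** [theta j] has to dominate all levels [j' >= j] although [w] drops at [c * n]. The two estimates
    are therefore switched at [2 * c * n]: if [j' > 2 * c * n] and [j <= c * n], then even [j' / 2]
    exceeds [j]. *)
Lemma level_bounds_theta j j' l : (0 < j <= j')%N -> n = (j' + l)%N -> (k <= l)%N ->
  (level_bound k j' l)%:R <= theta j * ('C(n, k) * odd_fact k)%:R \/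
  (rising (2 * l) n k)%:R <= theta j * (k`! * ('C(n, k) * odd_fact k))%:R.
Proof.
move=> /andP[j0 jj'] nE kl; have [e0 e1] := andP eps_b.
have jjR : j%:R <= j'%:R :> R by rewrite ler_nat.
have rn : 0 <= rate R k / n%:R by rewrite divr_ge0 // ltW.
have kn : (k <= n)%N by rewrite nE (leq_trans kl) ?leq_addl.
have C0 : 0 < ('C(n, k) * odd_fact k)%:R :> R.
  by rewrite ltr0n muln_gt0 bin_gt0 kn odd_fact_gt0.
have [w0 wj] := andP (w_le j).
have [j'c|cj'] := leP j'%:R (2 * c * n%:R).
  left; rewrite -ler_pdivrMr //.
  have a2c : j'%:R / n%:R <= 2 * c by rewrite ler_pdivrMr.
  have h := small_level_bound_le (R := R) k2 nE kl.
  apply: (le_trans (h _)); first by rewrite (le_trans a2c) // /c; lra.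
  rewrite /theta ler_expR lerN2.
  have -> : j'%:R / n%:R * rate R k * (1 - 5 * (j'%:R / n%:R))
    = (1 - 5 * (j'%:R / n%:R)) * j'%:R * (rate R k / n%:R) by ring.
  apply: ler_wpM2r => //; apply: ler_pM => //; first by lra.
    by move: a2c; rewrite /c; lra.
  exact: le_trans jjR.
right.
have eb : 0 <= eps <= 1 by lra.
have kj : 3 * k%:R <= eps * j'%:R.
  by apply: (le_trans kc); rewrite ler_wpM2l ?ltW.
apply: le_trans (large_level_bound_le k2 nE kn2 eb kj) _.
rewrite ler_wpM2r // ler_expR lerN2.
have -> : (1 - eps) * (j'%:R / n%:R) * rate R k / 2
  = (1 - eps) * (j'%:R / 2) * (rate R k / n%:R) by ring.
apply: ler_wpM2r => //; apply: ler_wpM2l; first by lra.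
rewrite /w; case: ifP => [jc|_]; last by lra.
by move: cj' jc; rewrite -mulrA; move: (c * n%:R) => z; lra.
Qed.

(** Up to [c * n] the count is at most (2 n^2)^j against a decay n^(-(2 + delta/2) j); beyond, it is
    at most (2 e n / c)^j against n^(-(1 + delta/4) j). The second case dictates [rho]. *)
Lemma theta_term_le j : (0 < j <= n)%N ->
  ('C('C(n.*2, 2), j))%:R * theta j ^+ (2 * Num.truncn s) <= rho ^+ j.
Proof.
move=> /andP[j0 jn]; have [e0 e1] := andP eps_b; have [d0 d1] := andP d01.
have [w0 wj] := andP (w_le j).
have j1 : 1 <= j%:R :> R by rewrite (ler_nat R 1).
have c0 : 0 < c by rewrite /c; lra.
have ee : 1 <= expR 1 :> R by rewrite -expR0 ler_expR.
set N := 'C(n.*2, 2).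
have N2 : N%:R <= 2 * n%:R ^+ 2 :> R.
  rewrite -natrX -natrM ler_nat -mulnn -(leq_pmul2r (isT : 0 < 2)%N).
  have := bin_ffact n.*2 2; rewrite -/N -[2`!]/2%N => ->.
  rewrite 2!ffactnS ffactn0 muln1 -mul2n.
  apply: (@leq_trans (2 * n * (2 * n))); first by rewrite leq_mul2l leq_pred orbT.
  by rewrite leq_eqVlt; apply/orP; left; apply/eqP; ring.
have th : theta j ^+ (2 * Num.truncn s) <= expR (- ((2 + delta / 2) * w j * L)).
  rewrite /theta -expRM_natl ler_expR natrM mulrN lerN2.
  have tl : (2 + delta) * L <= 2 * (Num.truncn s)%:R * (rate R k / n%:R).
    have -> : (2 + delta) * L
      = 2 * ((1 + delta / 2) * (n%:R * L / rate R k)) * (rate R k / n%:R).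
      by field; rewrite !gt_eqF.
    by rewrite ler_wpM2r ?divr_ge0 ?(ltW r0) // ler_wpM2l.
  rewrite [leRHS](_ : _ = (1 - eps) * w j * (2 * (Num.truncn s)%:R * (rate R k / n%:R)));
    last by ring.
  apply: (@le_trans _ _ ((1 - eps) * w j * ((2 + delta) * L))); last first.
    by rewrite ler_wpM2l // mulr_ge0 //; lra.
  have -> : (1 - eps) * w j * ((2 + delta) * L) = (1 - eps) * (2 + delta) * (w j * L) by ring.
  rewrite -mulrA ler_wpM2r ?mulr_ge0 //.
  by rewrite /eps; nra.
have c2 : 2 <= 2 * expR 1 / c by rewrite ler_pdivlMr //; move: e1; rewrite /c; nra.
have rhoE : rho ^+ j = (2 * expR 1 / c) ^+ j * expR (- (delta / 4 * j%:R * L)).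
  by rewrite /rho exprMn -expRM_natl; congr (_ * expR _); ring.
have pe : 0 <= expR (- ((2 + delta / 2) * w j * L)) := expR_ge0 _.
apply: le_trans (ler_wpM2l (ler0n _ _) th) _; rewrite rhoE.
have [jc|cj] := leP j%:R (c * n%:R).
  have wE : w j = j%:R by rewrite /w jc.
  have NJ : ('C(N, j))%:R <= 2 ^+ j * expR (2 * j%:R * L).
    apply: (@le_trans _ _ (N%:R ^+ j)); first by rewrite -natrX ler_nat bin_le_exp.
    apply: (@le_trans _ _ ((2 * n%:R ^+ 2) ^+ j)); first by rewrite lerXn2r ?nnegrE // mulr_ge0 ?sqr_ge0.
    rewrite exprMn nL -exprM -expRM_natl natrM le_eqVlt; apply/orP; left; apply/eqP.
    by congr (_ * expR _); ring.
  apply: le_trans (ler_wpM2r pe NJ) _.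
  rewrite -[leLHS]mulrA -expRD wE; apply: ler_pM; rewrite ?exprn_ge0 ?expR_ge0 //.
    by rewrite lerXn2r ?nnegrE // (le_trans _ c2).
  rewrite ler_expR.
  by have := mulr_ge0 (mulr_ge0 (ltW d0) (ler0n _ j)) L0; lra.
have wE : w j = j%:R / 2 by rewrite /w leNgt cj.
have NJ : ('C(N, j))%:R <= (2 * expR 1 / c) ^+ j * expR (j%:R * L).
  (* [x] is [j] over an upper bound of [N], so [expR (N%:R * x)] is at most e^j and the binomial
     coefficient at most (e / x)^j. *)
  pose x : R := j%:R / (2 * n%:R ^+ 2).
  have x0 : 0 < x by rewrite divr_gt0 ?mulr_gt0 ?exprn_gt0 //; lra.
  have h := bin_mul_exp_le N j (ltW x0).
  have Nx : expR (N%:R * x) <= expR 1 ^+ j.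
    rewrite -expRM_natl ler_expR mulr1 /x mulrA ler_pdivrMr ?mulr_gt0 ?exprn_gt0 //.
    by rewrite mulrC ler_wpM2l.
  have := le_trans h Nx; rewrite -ler_pdivlMr ?exprn_gt0 // => /le_trans; apply.
  rewrite expRM_natl -nL -expr_div_n -exprMn.
  have A0 : 0 <= expR 1 / x by rewrite divr_ge0 ?expR_ge0 ?(ltW x0).
  have B0 : 0 <= 2 * expR 1 / c * n%:R.
    by rewrite mulr_ge0 ?(ltW n0) // (le_trans _ c2).
  suff h2 : expR 1 / x <= 2 * expR 1 / c * n%:R by apply: lerXn2r; rewrite ?nnegrE.
  rewrite /x invf_div mulrA ler_pdivrMr; last by lra.
  have -> : 2 * expR 1 / c * n%:R * j%:R = 2 * expR 1 * n%:R * (j%:R / c) by ring.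
  have -> : expR 1 * (2 * n%:R ^+ 2) = 2 * expR 1 * n%:R * n%:R :> R by ring.
  rewrite ler_wpM2l ?mulr_ge0 ?expR_ge0 ?(ltW n0) //.
  by rewrite ler_pdivlMr // mulrC ltW.
apply: le_trans (ler_wpM2r pe NJ) _.
rewrite -[leLHS]mulrA -expRD wE ler_wpM2l ?exprn_ge0 ?(le_trans _ c2) //.
by rewrite ler_expR; lra.
Qed.

Lemma worst_tv_upper : rho <= 1 / 2 ->
  worst_tv (@matching_step R n k) (@matching_pi R n) s ^+ 2 <= 2 * rho.
Proof.
move=> rho2; have kn : (k <= n)%N by move: kn2; clear; lia.
have k0 : (0 < k)%N by rewrite (leq_trans _ k2).
have th0 : theta 0 = 1.
  rewrite /theta /w mulr_ge0 ?mulr0 ?mul0r ?oppr0 ?expR0 //.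
  by have [e0 _] := andP eps_b; rewrite /c; lra.
have c0 : 0 < c by have [e0 _] := andP eps_b; rewrite /c; lra.
have rho0 : 0 <= rho by rewrite /rho !mulr_ge0 ?invr_ge0 ?expR_ge0 ?(ltW c0).
apply: le_trans (worst_tv_sqr_le kn s k0 th0 (fun j => expR_ge0 _) level_bounds_theta) _.
apply: (@le_trans _ _ (\sum_(1 <= j < n.+1) rho ^+ j)).
  by rewrite !big_nat; apply: ler_sum => j /andP[j0 jn]; apply: theta_term_le; rewrite j0.
rewrite big_add1 /= big_mkord; under eq_bigr do rewrite exprS.
rewrite -mulr_sumr mulrC ler_wpM2r // geometric_tail_le // rho0.
by rewrite rho2.
Qed.

End UpperBound.

(** * Cutoff *)

Local Open Scope classical_set_scope.
Local Open Scope ring_scope.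

(** The upper bound says that survivals of two pairs are negatively correlated. The difference is
    factored explicitly; its sign is settled by replacing [p] by its lower bound [2 * q]. *)
Lemma keep2_bounds (R : realType) (n k : nat) : (2 <= k)%N -> (2 * k <= n)%N ->
  0 <= keep2 R n k <= keep1 R n k ^+ 2.
Proof.
move=> k2 kn.
have k2R : 2 <= k%:R :> R by rewrite (ler_nat R 2).
have knR : 2 * k%:R <= n%:R :> R by rewrite -natrM ler_nat.
rewrite /keep2 /keep1; move: (k%:R) (n%:R) k2R knR => q p q2 qp.
have p1 : 0 < p - 1 by lra.
have p0 : 0 < p by lra.
have q1 : 0 < 2 * q - 1 by lra.
have q3 : 0 < 2 * q - 3 by lra.
apply/andP; split.
  rewrite divr_ge0 ?mulr_ge0 ?(ltW p0) ?(ltW p1) //.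
  by rewrite !addr_ge0 ?divr_ge0 ?mulr_ge0 //; lra.
rewrite -subr_ge0.
have -> : (1 - q / p + q / p / (2 * q - 1)) ^+ 2 -
  ((p - q) * (p - q - 1) + 2 * q * (p - q) / (2 * q - 1)
    + q * (q - 1) / ((2 * q - 1) * (2 * q - 3))) / (p * (p - 1))
  = q * (q - 1) * (p * (8 * q ^+ 2 - 20 * q + 10) - (8 * q ^+ 3 - 20 * q ^+ 2 + 12 * q))
     / (p ^+ 2 * (p - 1) * (2 * q - 1) ^+ 2 * (2 * q - 3)).
  by field; rewrite !gt_eqF.
rewrite divr_ge0 //; last by rewrite !mulr_ge0 ?exprn_ge0 // ltW.
have s0 : 2 <= 8 * q ^+ 2 - 20 * q + 10 by nra.
rewrite mulr_ge0 //; first by rewrite mulr_ge0; lra.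
rewrite subr_ge0; apply: (@le_trans _ _ (2 * q * (8 * q ^+ 2 - 20 * q + 10))).
  by rewrite -subr_ge0 (_ : _ - _ = q * (8 * q ^+ 2 - 20 * q + 8)); [apply: mulr_ge0; nra|ring].
by rewrite ler_wpM2r //; lra.
Qed.

Section FixedSize.
Context (R : realType) (n k : nat).
Hypotheses (k2 : (2 <= k)%N) (kn2 : (2 * k <= n)%N).
Let kn : (k <= n)%N. Proof. by move: kn2; clear; lia. Qed.
Let n0 : 0 < n%:R :> R. Proof. by rewrite ltr0n; move: kn2 k2; clear; lia. Qed.
Let k2R : 2 <= k%:R :> R. Proof. by rewrite (ler_nat R 2). Qed.
Let r0 : 0 < rate R k. Proof. by have := rate_ge R k2; lra. Qed.
Let L0 : 0 <= ln n%:R :> R.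
Proof. by rewrite ln_ge0 // (ler_nat R 1); move: kn2 k2; clear; lia. Qed.

Lemma worst_tv_le1 (s : R) : worst_tv (@matching_step R n k) (@matching_pi R n) s <= 1.
Proof.
apply: bigmax_le => // x _; apply: bigmax_le => // B _.
have prob (mu : matching n -> R) : (forall y, 0 <= mu y) -> \sum_y mu y = 1 ->
    0 <= pr mu B <= 1.
  move=> mu0 mu1; rewrite /pr sumr_ge0 //= -mu1 [leRHS](bigID (mem B)) /=.
  by rewrite lerDl sumr_ge0.
have h1 : 0 <= pr (iter_step (@matching_step R n k) (Num.truncn s) x) B <= 1.
  apply: prob => [y|]; last exact: iter_step_sum.
  by rewrite iter_stepE // divr_ge0 ?exprn_ge0 // kpow_ge0.
have h2 : 0 <= pr (@matching_pi R n) B <= 1.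
  apply: prob => [y|]; first by rewrite matching_piE invr_ge0.
  under eq_bigr do rewrite matching_piE.
  rewrite sumr_const card_matching -[LHS]mulr_natl divff //.
  by rewrite pnatr_eq0 -lt0n card_matching_gt0.
by rewrite ler_norml; lra.
Qed.

Lemma cutoff_timeE : cutoff_time R n k = n%:R * ln n%:R / rate R k.
Proof. by []. Qed.

Lemma ln_le_cutoff_time : ln n%:R <= cutoff_time R n k.
Proof.
rewrite cutoff_timeE ler_pdivlMr // mulrC ler_wpM2r //.
apply: (@le_trans _ _ k%:R); last by rewrite ler_nat.
by rewrite /rate gerBl divr_ge0 //; have := k2R; lra.
Qed.

(** A pair survives a step with probability 1 - q, where q <= k / n <= delta / 2. Then (1 - delta) /
    (1 - q) <= 1 - delta / 2, so at least n^(delta/2) initial pairs are expected to survive. *)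
Lemma worst_tv_lower (delta : R) : 0 < delta < 1 -> k%:R / n%:R <= delta / 2 ->
  1 - 6 * expR (- (delta / 2 * ln n%:R))
    <= worst_tv (@matching_step R n k) (@matching_pi R n) ((1 - delta) * cutoff_time R n k).
Proof.
move=> /andP[d0 d1] kd; set s := (1 - delta) * _.
have kn2' : (k + 2 <= n)%N by move: kn2 k2; clear; lia.
have /andP[r20 r21] := keep2_bounds R k2 kn2.
have s0 : 0 <= s.
  by rewrite mulr_ge0 ?subr_ge0 ?(ltW d1) // (le_trans L0) // ln_le_cutoff_time.
pose q : R := rate R k / n%:R.
have k1E : keep1 R n k = 1 - q.
  by rewrite /keep1 /q /rate; field; rewrite gt_eqF //=; have := k2R; lra.
have q0 : 0 < q by rewrite divr_gt0.
have qd : q <= delta / 2.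
  apply: le_trans kd; rewrite ler_pM2r ?invr_gt0 // /rate gerBl divr_ge0 //; have := k2R; lra.
have q1 : 0 < 1 - q by lra.
have m_ge : expR (delta / 2 * ln n%:R) <= n%:R * keep1 R n k ^+ Num.truncn s.
  have -> : expR (delta / 2 * ln n%:R) = n%:R * expR (- ((1 - delta / 2) * ln n%:R)).
    by rewrite -{2}[n%:R]lnK // -expRD; congr expR; ring.
  rewrite ler_pM2l //.
  (* Inverse form of 1 + q / (1 - q) <= exp (q / (1 - q)), whose left side is 1 / (1 - q). *)
  have e1 : expR (- (q / (1 - q))) <= keep1 R n k.
    rewrite k1E expRN -[leRHS]invrK lef_pV2 ?posrE ?expR_gt0 ?invr_gt0 //.
    apply: le_trans (expR_ge1Dx _).
    by rewrite le_eqVlt; apply/orP; left; apply/eqP; field; rewrite gt_eqF.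
  apply: (@le_trans _ _ (expR (- (q / (1 - q))) ^+ Num.truncn s)); last first.
    by rewrite lerXn2r ?nnegrE ?expR_ge0 // k1E ltW.
  rewrite -expRM_natl ler_expR mulrN lerN2.
  apply: (@le_trans _ _ (s * (q / (1 - q)))).
    apply: ler_wpM2r; first by apply: divr_ge0; exact: ltW.
    by rewrite truncn_le.
  rewrite /s cutoff_timeE.
  have -> : n%:R * ln n%:R / rate R k = ln n%:R / q.
    by rewrite /q; field; rewrite !gt_eqF.
  have -> : (1 - delta) * (ln n%:R / q) * (q / (1 - q)) = (1 - delta) / (1 - q) * ln n%:R.
    move: q q0 q1 {k1E qd e1} => q q0 q1.
    by field; rewrite !gt_eqF.
  by rewrite ler_wpM2r // ler_pdivrMr //; nra.
have m0 : 0 < n%:R * keep1 R n k ^+ Num.truncn s by apply: lt_le_trans m_ge; exact: expR_gt0.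
apply: le_trans (worst_tv_ge k2 kn2' r21 r20 m0).
rewrite lerB // expRN -/(_ / _) ler_pM2l // lef_pV2 ?posrE ?expR_gt0 //.
Qed.

Lemma worst_tv_upper_ln (delta : R) (c := delta / 80) : 0 < delta < 1 ->
  k%:R / n%:R <= delta * c / 12 -> 2 / delta <= ln n%:R ->
  2 * expR 1 / c * expR (- (delta / 4 * ln n%:R)) <= 1 / 2 ->
  worst_tv (@matching_step R n k) (@matching_pi R n) ((1 + delta) * cutoff_time R n k) ^+ 2
    <= 2 * (2 * expR 1 / c * expR (- (delta / 4 * ln n%:R))).
Proof.
move=> d01 kd Ld; have /andP[d0 d1] := d01.
have cE : delta / 8 / 10 = c by rewrite /c; lra.
have := @worst_tv_upper R n k delta ((1 + delta) * cutoff_time R n k) k2 kn2 d01.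
rewrite cE; apply.
  by move: kd; rewrite ler_pdivrMr //; lra.
rewrite -cutoff_timeE; have t2 := le_trans Ld ln_le_cutoff_time.
have := truncnS_gt ((1 + delta) * cutoff_time R n k); rewrite -natr1.
(* Half of [delta] pays for rounding the time down, which loses less than one step. *)
have : 1 <= delta / 2 * cutoff_time R n k.
  by move: t2; rewrite ler_pdivrMr //; lra.
by move: (cutoff_time R n k) => t; lra.
Qed.

End FixedSize.

(** * Passage to the limit *)

Lemma near_ln_ge (R : realType) (A : R) : \forall n \near \oo, A <= ln n%:R.
Proof.
near=> n.
have h : expR A <= n%:R by near: n; exact: nbhs_infty_ger.
by rewrite -(expRK A) ler_ln ?posrE ?expR_gt0 // (lt_le_trans _ h) ?expR_gt0.
Unshelve. all: by end_near. Qed.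

Lemma near_expN_ln_le (R : realType) (a e : R) : 0 < a -> 0 < e ->
  \forall n \near \oo, expR (- (a * ln n%:R)) <= e.
Proof.
move=> a0 e0; near=> n.
have h : - ln e / a <= ln n%:R by near: n; exact: near_ln_ge.
rewrite -[leRHS]lnK ?posrE // ler_expR lerNl.
by move: h; rewrite ler_pdivrMr // mulrC.
Unshelve. all: by end_near. Qed.

Section Asymptotics.
Context (R : realType) (k : nat -> nat).
Hypothesis hk : forall n : nat, (2 <= n)%N -> (2 <= k n <= n)%N.
Hypothesis hlim : (k n)%:R / n%:R @[n --> \oo] --> (0 : R).

Let near_ratio (e : R) : 0 < e -> \forall n \near \oo, (k n)%:R / n%:R <= e.
Proof.
move=> e0; move/cvgrPdist_le : hlim => /(_ _ e0); apply: filterS => n.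
by rewrite sub0r normrN ger0_norm // divr_ge0.
Qed.

Let near_k2 : \forall n \near \oo, (2 <= k n)%N.
Proof. by near=> n; have /andP[] : (2 <= k n <= n)%N by apply: hk; near: n; exact: nbhs_infty_ge.
Unshelve. all: by end_near. Qed.

Let near_k2n : \forall n \near \oo, (2 * k n <= n)%N.
Proof.
near=> n.
have n0 : 0 < n%:R :> R by rewrite ltr0n; near: n; exact: nbhs_infty_gt.
have : (k n)%:R / n%:R <= 1 / 2 :> R by near: n; apply: near_ratio; lra.
rewrite ler_pdivrMr // => h; rewrite -(ler_nat R) natrM; lra.
Unshelve. all: by end_near. Qed.

Let d (s : R) n : R := worst_tv (@matching_step R n (k n)) (@matching_pi R n)
  (s * cutoff_time R n (k n)).

Lemma cvg_lower (delta : R) : 0 < delta < 1 -> d (1 - delta) n @[n --> \oo] --> (1 : R).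
Proof.
move=> d01; apply/cvgrPdist_le => e e0; near=> n.
have k2 : (2 <= k n)%N by near: n; exact: near_k2.
have kn : (2 * k n <= n)%N by near: n; exact: near_k2n.
have kd : (k n)%:R / n%:R <= delta / 2 by near: n; apply: near_ratio; lra.
have le1 := worst_tv_le1 kn ((1 - delta) * cutoff_time R n (k n)).
have ge := worst_tv_lower k2 kn d01 kd.
have : expR (- (delta / 2 * ln n%:R)) <= e / 6.
  by near: n; apply: near_expN_ln_le; lra.
rewrite ger0_norm ?subr_ge0 // /d; lra.
Unshelve. all: by end_near. Qed.

Lemma cvg_upper (delta : R) : 0 < delta < 1 -> d (1 + delta) n @[n --> \oo] --> (0 : R).
Proof.
move=> d01; apply/cvgrPdist_le => e e0.
pose c : R := delta / 80.
have c0 : 0 < c by rewrite /c; lra.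
pose M : R := 2 * expR 1 / c.
have M0 : 0 < M by apply: divr_gt0 => //; apply: mulr_gt0 => //; exact: expR_gt0.
have M2 : 0 < M * 2 by apply: mulr_gt0.
near=> n.
have k2 : (2 <= k n)%N by near: n; exact: near_k2.
have kn : (2 * k n <= n)%N by near: n; exact: near_k2n.
have kd : (k n)%:R / n%:R <= delta * c / 12.
  by near: n; apply: near_ratio; rewrite divr_gt0 ?mulr_gt0 //; lra.
have Ld : 2 / delta <= ln n%:R by near: n; exact: near_ln_ge.
have r1 : M * expR (- (delta / 4 * ln n%:R)) <= 1 / 2.
  rewrite mulrC -ler_pdivlMr //; near: n; apply: near_expN_ln_le; first by lra.
  by apply: divr_gt0 => //; lra.
have r2 : 2 * (M * expR (- (delta / 4 * ln n%:R))) <= e ^+ 2.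
  rewrite mulrCA mulrA mulrC -ler_pdivlMr //.
  near: n; apply: near_expN_ln_le; first by lra.
  by apply: divr_gt0; [exact: exprn_gt0|exact: M2].
have := le_trans (worst_tv_upper_ln k2 kn d01 kd Ld r1) r2.
have d0 : 0 <= d (1 + delta) n by apply: bigmax_ge_id.
rewrite sub0r normrN ger0_norm // -/(d (1 + delta) n) => h.
by rewrite -(@ler_pXn2r _ 2) ?nnegrE // ltW.
Unshelve. all: by end_near. Qed.

End Asymptotics.

Theorem theorem1p5 (R : realType) (k : nat -> nat)
    (hk : forall n : nat, (2 <= n)%N -> (2 <= k n <= n)%N)
    (hlim : (k n)%:R / n%:R @[n --> \oo] --> (0 : R)) :
  [/\ forall n : nat, (2 <= n)%N ->
        cutoff_time R n (k n) =
        n%:R / (k n)%:R * ln n%:R * (1 / (1 - 1 / (2 * (k n)%:R - 1))),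
      cutoff_at (fun n : nat => @matching_step R n (k n))
        (@matching_pi R)
        (fun n : nat => cutoff_time R n (k n)) &
      (forall m : nat, \forall n \near \oo, (m <= k n)%N) ->
        exists e : nat -> R,
          e n @[n --> \oo] --> (0 : R) /\
          forall n : nat, (2 <= n)%N ->
            cutoff_time R n (k n) = n%:R / (k n)%:R * ln n%:R * (1 + e n)].
Proof.
have k2R n : (2 <= n)%N -> 2 <= (k n)%:R :> R.
  by move=> /hk /andP[k2 _]; rewrite (ler_nat R 2).
have timeE n : (2 <= n)%N -> cutoff_time R n (k n) =
    n%:R / (k n)%:R * ln n%:R * (1 / (1 - 1 / (2 * (k n)%:R - 1))).
  move=> /k2R; rewrite /cutoff_time; move: (k n)%:R => q q2.
  by field; rewrite !gt_eqF //=; nra.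
split=> //.
  move=> delta d01; split.
    apply: (fun h => (cvg_limn_einf_sup h).1); apply: cvg_EFin; first exact: nearW.
exact: (cvg_lower hk hlim d01).
  apply: (fun h => (cvg_limn_einf_sup h).2); apply: cvg_EFin; first exact: nearW.
  exact: (cvg_upper hk hlim d01).
move=> kinf; exists (fun n => 1 / (1 - 1 / (2 * (k n)%:R - 1)) - 1); split.
  apply/cvgrPdist_le => e e0; near=> n.
  have n2 : (2 <= n)%N by near: n; exact: nbhs_infty_ge.
  have : ((Num.truncn e^-1).+1 <= k n)%N by near: n; exact: kinf.
  move=> ke; have : e^-1 <= (k n)%:R.
    by rewrite ltW // (lt_le_trans (truncnS_gt _)) // ler_nat.
  have := k2R _ n2; move: (k n)%:R => q q2.
  rewrite -[leLHS]div1r ler_pdivrMr // => qe.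
  (* For [q >= 2] this is at most 1 / q, and [qe] bounds 1 / q by [e]. *)
  have -> : 1 / (1 - 1 / (2 * q - 1)) - 1 = 1 / (2 * q - 2).
    by field; rewrite !gt_eqF //=; lra.
  rewrite sub0r normrN ger0_norm; last by rewrite divr_ge0 //; lra.
  by rewrite ler_pdivrMr; nra.
by move=> n n2; rewrite timeE // addrCA subrr addr0.
Unshelve. all: by end_near. Qed.
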